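(* Let $q_1,q_2$ be coprime positive integers, $Q=q_1q_2$, and let $V:\mathbb{Z}^2\to\mathbb{R}$ be $(q_1,q_2)$-periodic. For $m\in\{1,\dots,Q\}$ and $k\in[0,1)^2$ let $\lambda_m(k)$ be the $m$-th smallest eigenvalue of $D_V(k)$. Let $\lambda_*$ be an extremum (the maximum or the minimum value) of $\lambda_m(k)$ over $k\in[0,1)^2$. Then the level set $\{k\in[0,1)^2:\lambda_m(k)=\lambda_*\}$ has cardinality at most $9q_1q_2-3$.
   Context: $V$ is $(q_1,q_2)$-periodic if $V(n_1,n_2)=V(n_1+q_1,n_2)=V(n_1,n_2+q_2)$ for all $(n_1,n_2)\in\mathbb{Z}^2$. The operator $\Delta+V$ acts on $u:\mathbb{Z}^2\to\mathbb{C}$ by $((\Delta+V)u)(n)=u(n_1+1,n_2)+u(n_1-1,n_2)+u(n_1,n_2+1)+u(n_1,n_2-1)+V(n)u(n)$. For $k=(k_1,k_2)\in\mathbb{R}^2$, $D_V(k)$ is the $Q\times Q$ matrix of $\Delta+V$ acting on the space of functions $u$ satisfying the Floquet–Bloch conditions $u(n_1+q_1,n_2)=e^{2\pi i k_1}u(n)$ and $u(n_1,n_2+q_2)=e^{2\pi ik_2}u(n)$ for all $n\in\mathbb{Z}^2$, written in the coordinates $\{u(n_1,n_2):1\le n_1\le q_1,\ 1\le n_2\le q_2\}$; it is Hermitian since $V$ is real, so its eigenvalues are real and $\lambda_1(k)\le\dots\le\lambda_Q(k)$. *)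

(* Defs.v *)
From HB Require Import structures.
From mathcomp Require Import all_boot all_order all_algebra.
From mathcomp Require Import all_classical all_reals.
From mathcomp Require Import trigo.
From mathcomp Require Import complex.

Set Implicit Arguments.
Unset Strict Implicit.
Unset Printing Implicit Defensive.

Import Order.TTheory GRing.Theory Num.Theory.

Local Open Scope ring_scope.
Local Open Scope complex_scope.

Section Floquet.
Variables (R : realType) (q1 q2 : nat).

Definition qperiodic (V : int * int -> R) : Prop :=
  forall n : int * int,
    V n = V (n.1 + q1%:Z, n.2) /\ V n = V (n.1, n.2 + q2%:Z).

Definition expi2pi (t : R) : R[i] := (cos (2 * pi * t)) +i* (sin (2 * pi * t)).

Definition schrodinger (V : int * int -> R) (u : int * int -> R[i])
    (n : int * int) : R[i] :=
  u (n.1 + 1, n.2) + u (n.1 - 1, n.2) + u (n.1, n.2 + 1) + u (n.1, n.2 - 1)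
  + (V n)%:C * u n.

Definition fl_site (c : 'I_q1 * 'I_q2) : int * int :=
  ((nat_of_ord c.1)%:Z + 1, (nat_of_ord c.2)%:Z + 1).

(* The unique function satisfying the Floquet-Bloch conditions
   u(n1+q1,n2) = e^{2 pi i k1} u(n), u(n1,n2+q2) = e^{2 pi i k2} u(n),
   whose coordinates are u(fl_site c) = [c == b]. *)
Definition floquet_basis (k1 k2 : R) (b : 'I_q1 * 'I_q2) (n : int * int)
    : R[i] :=
  let d1 := n.1 - (fl_site b).1 in
  let d2 := n.2 - (fl_site b).2 in
  if ((q1%:Z %| d1)%Z && (q2%:Z %| d2)%Z)
  then expi2pi k1 ^ (d1 %/ q1%:Z)%Z * expi2pi k2 ^ (d2 %/ q2%:Z)%Z
  else 0.

Definition fl_coord (a : 'I_(q1 * q2)) : 'I_q1 * 'I_q2 :=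
  enum_val (cast_ord (esym (mxvec_cast q1 q2)) a).

(* D_V(k): the matrix of Delta + V on the Floquet-Bloch space, written in the
   coordinates {u(n) : 1 <= n1 <= q1, 1 <= n2 <= q2} *)
Definition DV (V : int * int -> R) (k1 k2 : R) : 'M[R[i]]_(q1 * q2) :=
  \matrix_(a, b)
     schrodinger V (floquet_basis k1 k2 (fl_coord b)) (fl_site (fl_coord a)).

End Floquet.

(* lam : 'I_n -> R lists the eigenvalues of A (with multiplicity) in
   nondecreasing order: lam i is the (i+1)-th smallest eigenvalue. *)
Definition sorted_eigenvalues (R : realType) (n : nat) (A : 'M[R[i]]_n)
    (lam : 'I_n -> R) : Prop :=
  (forall i j : 'I_n, (i <= j)%N -> lam i <= lam j) /\
  char_poly A = \prod_(i < n) ('X - ((lam i)%:C)%:P).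

Definition in_unit_square (R : realType) (k : R * R) : Prop :=
  0 <= k.1 < 1 /\ 0 <= k.2 < 1.

Definition is_extremum (R : realType) (f : R * R -> R) (ls : R) : Prop :=
  ((forall k, in_unit_square k -> f k <= ls) \/
   (forall k, in_unit_square k -> ls <= f k)) /\
  exists k, in_unit_square k /\ f k = ls.

(* Main.v *)
(* Write x = exp(2 pi i k1), y = exp(2 pi i k2).  Expanding the determinant over
   the choices of a neighbour at every site gives
     det (D_V(k) - lambda) = sum_f c_f x^(I_f) y^(J_f),  c_f real,
   where I_f, J_f are winding numbers: since a permutation of the sites has zero
   total displacement, q1 I_f and q2 J_f count the signed horizontal and vertical
   steps, so q1 |I_f| + q2 |J_f| <= q1 q2.  As q1 and q2 are coprime, equality
   holds only for the four vertices of this diamond, where c_f = +-1.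

   At a point of the level set of an extremum this Laurent polynomial vanishes
   together with its logarithmic derivative in x: eigenvalues are Lipschitz in k
   by Weyl's inequality, so the product of the lambda_i(k) - lambda is quadratically
   small if lambda is a multiple eigenvalue, and has constant sign nearby if it is
   simple.  Hence, for the polynomial F = x^q2 y^q1 det (D_V - lambda) of bidegree
   (2 q2, 2 q1), every such point is a common zero of F and dF/dx, and there are at
   most deg_y Res_x(F, dF/dx) <= 8 q1 q2 - 2 q1 of those.  The resultant is not zero
   because for large y the vertices of the diamond dominate and F(., y) has no
   multiple root. *)
Require Import Defs.
From HB Require Import structures.
From mathcomp Require Import all_boot all_order all_algebra.
From mathcomp Require Import all_classical all_reals.
From mathcomp Require Import perm spectral topology normedtype derive.
From mathcomp Require Import trigo.
From mathcomp Require Import complex.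
From mathcomp Require Import zify ring lra.
Import Order.TTheory GRing.Theory Num.Theory.
Import numFieldNormedType.Exports.
Local Open Scope ring_scope.
Set Implicit Arguments.
Unset Strict Implicit.
Unset Printing Implicit Defensive.

(** * Multiplicity of the roots of a resultant *)

(** Every Leibniz term takes one factor from each of the first [r] rows. *)
Lemma dvdp_det_rows (K : fieldType) n r (M : 'M[{poly K}]_n) (d : {poly K}) :
  (r <= n)%N -> (forall i j : 'I_n, (i < r)%N -> d %| M i j) ->
  d ^+ r %| \det M.
Proof.
move=> ler dM; rewrite /determinant.
apply: (big_ind (fun p => d ^+ r %| p)) => [|p q|s _]; first exact: dvdp0.
  exact: dvdp_add.
apply: dvdp_mull.
have -> : d ^+ r = \prod_(i < n) (if (i < r)%N then d else 1).
  by rewrite -big_mkcond -(big_ord_widen_cond n xpredT (fun=> d)) // prodr_const card_ord.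
apply: (big_ind2 (fun p q => p %| q)) => [//|p p' q q'|i _]; first exact: dvdp_mul.
by case: ifP => [/dM //|_]; rewrite dvd1p.
Qed.

(** In characteristic zero the numbers 0, ..., n-1 are distinct, and at least [n - size xs] of them
    avoid [xs]. This completes the common roots to a full set of Vandermonde nodes. *)
Lemma uniq_extension (K : numDomainType) (xs : seq K) n :
  uniq xs -> (size xs <= n)%N ->
  exists2 ys, uniq (xs ++ ys) & size (xs ++ ys) = n.
Proof.
move=> xs_uniq le_n.
pose c := [seq x <- [seq i%:R : K | i <- iota 0 n] | x \notin xs].
have c_uniq : uniq c.
  rewrite filter_uniq // map_inj_uniq ?iota_uniq // => i j /eqP.
  by rewrite eqr_nat => /eqP.
have size_c : (n - size xs <= size c)%N.
  rewrite leq_subLR -size_cat -[X in (X <= _)%N](size_iota 0 n).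
  rewrite -(size_map (fun i => i%:R : K)); apply: uniq_leq_size.
    rewrite map_inj_uniq ?iota_uniq // => i j /eqP.
    by rewrite eqr_nat => /eqP.
  by move=> x xi; rewrite mem_cat mem_filter xi andbT orbN.
exists (take (n - size xs) c); last first.
  by rewrite size_cat size_takel // subnKC.
rewrite cat_uniq xs_uniq take_uniq // andbT /=.
apply/hasPn => x /mem_take; by rewrite mem_filter => /andP[].
Qed.

(* Multiply the Sylvester matrix by a Vandermonde matrix whose first nodes are
   the common roots [xs]: the corresponding columns vanish at [c]. *)
Lemma resultant_root_mult (K : numFieldType) (f g : {poly {poly K}}) (c : K)
    (xs : seq K) :
  uniq xs -> (size xs <= (size g).-1 + (size f).-1)%N ->
  (forall x, x \in xs -> f.[x%:P].[c] = 0 /\ g.[x%:P].[c] = 0) ->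
  ('X - c%:P) ^+ size xs %| resultant f g.
Proof.
set n := (_ + _)%N => xs_uniq le_n fg0.
have [ys a_uniq sz_a] := uniq_extension xs_uniq le_n.
set a := xs ++ ys in a_uniq sz_a.
pose v : 'rV[K]_n := \row_i a`_i.
pose W := map_mx polyC (Vandermonde n v).
have detW : (\det W %= 1)%R.
  rewrite det_map_mx polyC_eqp1 det_Vandermonde.
  apply/prodf_neq0 => i _; apply/prodf_neq0 => j lt_ij.
  rewrite !mxE subr_eq0 nth_uniq ?sz_a ?ltn_ord //.
  by rewrite neq_ltn lt_ij orbT.
rewrite /resultant -/n.
(* The factor det W is a nonzero constant. After transposition, row i holds the values at the i-th
   node of the polynomials X^k f and X^k g. *)
suff : ('X - c%:P) ^+ size xs %| \det (W^T *m (Sylvester_mx f g)^T).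
  by rewrite det_mulmx !det_tr (eqp_dvdr _ (eqp_mulr _ detW)) mul1r.
apply: dvdp_det_rows => // i j lt_i; rewrite mxE.
have xi : a`_i \in xs by rewrite nth_cat lt_i mem_nth.
have [f0 g0] := fg0 _ xi.
have row_eval (r : {poly {poly K}}) k : (size ('X^k * r)%R <= n)%N ->
    \sum_(l < n) (a`_i ^+ l)%:P * ('X^k * r)`_l = ('X^k * r).[(a`_i)%:P].
  move=> sz; rewrite (horner_coef_wide _ sz); apply: eq_bigr => l _.
  by rewrite mulrC polyC_exp.
have root_dvd (r : {poly {poly K}}) k : r.[(a`_i)%:P].[c] = 0 ->
    'X - c%:P %| ('X^k * r).[(a`_i)%:P].
  by move=> r0; rewrite hornerM dvdp_mull // dvdp_XsubCl; apply/rootP.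
have szX (r : {poly {poly K}}) k m : (k < m)%N ->
    (size ('X^k * r)%R <= m + (size r).-1)%N.
  move=> lt_k; have [->|r0] := eqVneq r 0; first by rewrite mulr0 size_poly0.
  rewrite mulrC size_mulXn //; have := size_poly_gt0 r; rewrite r0.
  by case: (size r) => // s _; rewrite addnS -addSn leq_add2r.
under eq_bigr do rewrite !mxE.
case: (fintype.split j) => k.
  under eq_bigr do rewrite !mxE /= rVpoly_delta.
  by rewrite row_eval ?root_dvd // szX.
under eq_bigr do rewrite !mxE /= rVpoly_delta.
by rewrite row_eval ?root_dvd // /n addnC szX.
Qed.

(** * Degree of the resultant and number of common zeros *)

Lemma size_det_rows (K : fieldType) n (M : 'M[{poly K}]_n) (d : 'I_n -> nat) :
  (forall i j, (size (M i j) <= (d i).+1)%N) ->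
  (size (\det M) <= (\sum_i d i).+1)%N.
Proof.
move=> sM; rewrite /determinant.
apply: (leq_trans (size_sum _ _ _)); apply/bigmax_leqP => s _.
rewrite -signr_odd; case: odd; rewrite ?expr1 ?expr0 ?mulN1r ?mul1r ?size_polyN.
all: have := size_poly_prod_leq xpredT (fun i => M i (s i)); rewrite cardT size_enum_ord.
all: move=> /leq_trans; apply; rewrite leq_subLR.
all: rewrite -[X in (_ <= X + _)%N](card_ord n) -sum1_card addnS ltnS -big_split /=.
all: by apply: leq_sum => i _; rewrite add1n.
Qed.

(** The Sylvester matrix has [(size g).-1] rows of coefficients of [f], of degree at most [d], and
    [(size f).-1] rows of coefficients of [g], of degree at most [e]. *)
Lemma size_resultant (K : fieldType) (f g : {poly {poly K}}) d e :
  (forall i, (size (f`_i)%R <= d.+1)%N) -> (forall i, (size (g`_i)%R <= e.+1)%N) ->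
  (size (resultant f g) <= ((size g).-1 * d + (size f).-1 * e).+1)%N.
Proof.
move=> sf sg.
pose D (i : 'I_((size g).-1 + (size f).-1)) := if fintype.split i then d else e.
have -> : ((size g).-1 * d + (size f).-1 * e = \sum_i D i)%N.
  rewrite big_split_ord /= /D; congr (_ + _)%N.
    under eq_bigr => i _ do rewrite (unsplitK (inl _ i)).
    by rewrite sum_nat_const card_ord.
  under eq_bigr => i _ do rewrite (unsplitK (inr _ i)).
  by rewrite sum_nat_const card_ord.
apply: size_det_rows => i j; rewrite Sylvester_mxE /D.
by case: (fintype.split i) => k /=; case: (k <= j)%N; rewrite ?mulr1n ?mulr0n ?size_poly0.
Qed.

Lemma prod_XsubC_exp_dvdp (K : fieldType) (ys : seq K) (r : K -> nat) p :
  uniq ys -> (forall y, y \in ys -> ('X - y%:P) ^+ r y %| p) ->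
  \prod_(y <- ys) ('X - y%:P) ^+ r y %| p.
Proof.
elim: ys => [|y ys IH] /=; first by rewrite big_nil dvd1p.
move=> /andP[yn uy] h; rewrite big_cons Gauss_dvdp.
  rewrite h ?mem_head //=; apply: IH => // z zi; apply: h.
  by rewrite inE zi orbT.
rewrite big_seq; apply: (big_ind (fun q => coprimep _ q)).
- exact: coprimep1.
- by move=> q q' h1 h2; rewrite coprimepMr h1.
- move=> z zi; apply/coprimep_expl/coprimep_expr.
  rewrite coprimep_XsubC root_XsubC; apply: contraNneq yn => <-; exact: zi.
Qed.

Lemma horner_map_eval (K : comNzRingType) (f : {poly {poly K}}) (x y : K) :
  (map_poly (horner_eval y) f).[x] = f.[x%:P].[y].
Proof.
by have /= := horner_map (horner_eval y) f x%:P; rewrite !horner_evalE hornerC.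
Qed.

(** Group the zeros by ordinate y: those over y make y a root of the resultant of at least that
    multiplicity, so their total is at most its degree. As [f] is not identically zero on the line
    over y, at most deg f zeros lie there, which gives the size condition of
    [resultant_root_mult]. *)
Lemma common_zeros_bound (K : numFieldType) (f g : {poly {poly K}}) d e
    (s : seq (K * K)) :
  (forall i, (size (f`_i)%R <= d.+1)%N) -> (forall i, (size (g`_i)%R <= e.+1)%N) ->
  resultant f g != 0 -> uniq s ->
  (forall z, z \in s -> [/\ map_poly (horner_eval z.2) f != 0,
     f.[z.1%:P].[z.2] = 0 & g.[z.1%:P].[z.2] = 0]) ->
  (size s <= (size g).-1 * d + (size f).-1 * e)%N.
Proof.
move=> sf sg res0 us hs.
pose ys := undup [seq z.2 | z <- s].
pose xs y := [seq z.1 | z <- s & z.2 == y].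
have uxs y : uniq (xs y).
  rewrite map_inj_in_uniq ?filter_uniq // => -[x1 y1] [x2 y2].
  by rewrite !mem_filter /= => /andP[/eqP -> _] /andP[/eqP -> _] ->.
have sz_s : size s = (\sum_(y <- ys) size (xs y))%N.
  rewrite -(size_map snd s) -(sum1_size (map snd s)) -(big_undup_iterop_count addn) /=.
  apply: eq_big_seq => y _; rewrite Monoid.iteropE iter_addn_0 mul1n.
  by rewrite size_map size_filter count_map; apply: eq_count => z /=.
have dvd : \prod_(y <- ys) ('X - y%:P) ^+ size (xs y) %| resultant f g.
  apply: prod_XsubC_exp_dvdp (undup_uniq _) _ => y; rewrite mem_undup.
  move=> /mapP[[x0 y0] zs /= ->].
  have [fy0 _ _] := hs _ zs.
  apply: resultant_root_mult => //.
    have /= h := @max_poly_roots _ _ (xs y0) fy0.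
    have lt : (size (xs y0) < size (map_poly (horner_eval y0) f))%N.
      apply: h => //; apply/allP => x /mapP[[x1 y1]]; rewrite mem_filter /=.
      move=> /andP[/eqP -> zs1] ->; have [_ /= fz _] := hs _ zs1.
      by apply/rootP; rewrite horner_map_eval.
    have := leq_trans lt (size_poly _ _); case: (size f) => // m.
    by rewrite ltnS => /leq_trans -> //; rewrite leq_addl.
  move=> x /mapP[[x1 y1]]; rewrite mem_filter /= => /andP[/eqP -> zs1] ->.
  by have [_ ? ?] := hs _ zs1.
have := dvdp_leq res0 dvd.
have -> : size (\prod_(y <- ys) ('X - y%:P) ^+ size (xs y)) = (size s).+1.
  rewrite sz_s; elim: ys {dvd sz_s} => [|y l IH]; first by rewrite !big_nil size_poly1.
  rewrite !big_cons size_mul ?expf_neq0 ?polyXsubC_eq0 //; last first.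
    by rewrite -size_poly_gt0 IH.
  by rewrite size_exp_XsubC IH addnS.
by move=> /leq_trans /(_ (size_resultant sf sg)); rewrite ltnS.
Qed.

(** * Weyl's inequality *)

Section Weyl.
Local Open Scope complex_scope.
Local Open Scope sesquilinear_scope.
Variables (R : realType) (n : nat).
Implicit Types (A B : 'M[R[i]]_n) (lam mu : 'I_n -> R).

Lemma hermitian_diagonalization A lam :
  A ^t* = A -> sorted_eigenvalues A lam ->
  exists2 P : 'M[R[i]]_n, P \is unitarymx &
    A = P ^t* *m diag_mx (\row_i (lam i)%:C) *m P.
Proof.
move=> hA [_ cA].
have /orthomx_spectralP : A \is normalmx by apply/normalmxP; rewrite hA.
set P := spectralmx A; set d := spectral_diag A => eA.
have uP : P \is unitarymx by exact: spectral_unitarymx.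
have Pu := unitarymx_unit uP.
have cd : char_poly A = \prod_(i < n) ('X - (d 0 i)%:P).
  transitivity (char_poly (diag_mx d)); last first.
    rewrite char_poly_trig ?diag_mx_is_trig //.
    by apply: eq_bigr => i _; rewrite mxE eqxx.
  pose Q := map_mx polyC P; pose Q' := map_mx polyC (invmx P).
  have QQ : Q' *m Q = 1%:M by rewrite -map_mxM mulVmx // map_mx1.
  rewrite /char_poly /char_poly_mx {1}eA !map_mxM -/Q -/Q'.
  have -> : 'X%:M = Q' *m 'X%:M *m Q.
    by rewrite mul_mx_scalar -scalemxAl QQ scalemx1.
  rewrite -mulmxBl -mulmxBr !det_mulmx mulrAC -det_mulmx QQ det1 mul1r.
  by rewrite mul_mx_scalar -scalemxAl QQ scalemx1.
pose D : n.-tuple R[i] := [tuple d 0 i | i < n].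
pose L : n.-tuple R[i] := [tuple (lam i)%:C | i < n].
(* The spectral theorem lists the eigenvalues in an unknown order. Unique factorization of the
   characteristic polynomial supplies a permutation, which then reorders the rows of [P]. *)
have /tuple_permP[s es] : perm_eq L D.
  apply: prod_XsubC_eq; rewrite !big_map /index_enum.
  by move: cA; rewrite cd => <-.
have lamE i : (lam i)%:C = d 0 (s i).
  have := congr1 (fun u => nth 0 u i) es.
  rewrite -!tnth_nth !tnth_mktuple.
  by [].
exists (row_perm s P).
  apply/unitarymxP/matrixP => i j.
  have /matrixP/(_ (s i) (s j)) := unitarymxP uP.
  rewrite !mxE (inj_eq perm_inj) => <-; apply: eq_bigr => k _.
  by rewrite !mxE.
rewrite eA invmx_unitary //; apply/matrixP => a b.
rewrite !mxE (reindex_inj (@perm_inj _ s)); apply: eq_bigr => i _.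
by rewrite !mul_mx_diag !mxE lamE.
Qed.

Lemma diag_form (x : 'rV[R[i]]_n) lam :
  (x *m diag_mx (\row_i (lam i)%:C) *m x ^t*) 0 0 =
  \sum_i (lam i)%:C * `|x 0 i| ^+ 2.
Proof.
rewrite mxE; apply: eq_bigr => i _.
by rewrite mul_mx_diag !mxE normCK mulrAC mulrC.
Qed.

(** Each term is at most e (|v_a|^2 + |v_b|^2) / 2, and summing over all pairs (a, b) gives n e
    |v|^2. *)
Lemma mx_form_le A (v : 'rV[R[i]]_n) (e : R) :
  (forall a b, `|A a b| <= e%:C) ->
  `|(v *m A *m v ^t*) 0 0| <= (n%:R * e)%:C * \sum_i `|v 0 i| ^+ 2.
Proof.
move=> hA; rewrite mxE.
have -> : (n%:R * e)%:C * \sum_i `|v 0 i| ^+ 2 =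
    \sum_b \sum_a ((e%:C / 2) * (`|v 0 a| ^+ 2 + `|v 0 b| ^+ 2)).
  symmetry; under eq_bigr do rewrite -mulr_sumr big_split /= sumr_const card_ord.
  rewrite -mulr_sumr big_split /= sumr_const card_ord sumrMnl.
  set S := \sum_i _; rewrite -[S *+ n]mulr_natr rmorphM /= rmorph_nat.
  by field.
apply: le_trans (ler_norm_sum _ _ _) _; apply: ler_sum => b _.
rewrite !mxE mulr_suml; apply: le_trans (ler_norm_sum _ _ _) _.
apply: ler_sum => a _; rewrite !normrM norm_conjC.
have := hA a b; rewrite !normc_def.
set x := Num.sqrt _; set y := Num.sqrt _; set z := Num.sqrt _.
have -> : 2 = 2%:C :> R[i] by rewrite rmorph_nat.
rewrite -!rmorphXn -!rmorphD -fmorphV -!rmorphM /= !lecR => xe.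
have y0 : 0 <= y := sqrtr_ge0 _.
have z0 : 0 <= z := sqrtr_ge0 _.
have x0 : 0 <= x := sqrtr_ge0 _.
have h1 : y * z <= (y ^+ 2 + z ^+ 2) / 2.
  by have := sqr_ge0 (y - z); rewrite sqrrB; lra.
have h2 : 0 <= y * z by rewrite mulr_ge0.
have -> : y * x * z = x * (y * z) by ring.
have -> : e / 2 * (y ^+ 2 + z ^+ 2) = e * ((y ^+ 2 + z ^+ 2) / 2) by field.
exact: ler_pM.
Qed.

(* Courant-Fischer: the span of the eigenvectors of [A] of index [>= i] meets
   the span of those of [B] of index [<= i]. *)
Lemma weyl_inequality A B lam mu (e : R) (i : 'I_n) :
  A ^t* = A -> B ^t* = B ->
  sorted_eigenvalues A lam -> sorted_eigenvalues B mu ->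
  (forall a b, `|A a b - B a b| <= e%:C) ->
  lam i <= mu i + n%:R * e.
Proof.
move=> hA hB sA sB hAB.
have [P uP eA] := hermitian_diagonalization hA sA.
have [Q uQ eB] := hermitian_diagonalization hB sB.
case: sA sB => lam_mono _ [mu_mono _].
pose G := P *m Q ^t*.
(* The columns of [K] encode n - 1 linear conditions: x_j = 0 for j < i and (x G)_j = 0 for j > i.
   Column i is zero, so a nonzero solution exists. *)
pose K := \matrix_(a, j) (if (j < i)%N then (a == j)%:R else
  if (i < j)%N then G a j else 0) : 'M[R[i]]_n.
have /eqP/det0P[x x0 xK] : \det K = 0.
  rewrite (expand_det_col _ i) big1 // => a _.
  by rewrite mxE ltnn mul0r.
have xlow (j : 'I_n) : (j < i)%N -> x 0 j = 0.
  move=> lt; move/rowP/(_ j): xK; rewrite !mxE (bigD1 j) //= big1 => [|a na].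
    by rewrite mxE lt eqxx mulr1 addr0.
  by rewrite mxE lt (negPf na) mulr0.
pose y := x *m G.
have yhigh (j : 'I_n) : (i < j)%N -> y 0 j = 0.
  move=> lt; transitivity ((x *m K) 0 j); last by rewrite xK mxE.
  rewrite /y [LHS]mxE [RHS]mxE; apply: eq_bigr => a _.
  by rewrite [K a j]mxE lt ltnNge ltnW.
pose v := x *m P.
have vQ : v = y *m Q by rewrite /y /G /v mulmxA mulmxKtV.
have nx (w : 'rV[R[i]]_n) (U : 'M_n) : U \is unitarymx ->
    ((w *m U) *m (w *m U) ^t*) 0 0 = \sum_j `|w 0 j| ^+ 2.
  move=> uU; rewrite trmx_mul map_mxM mulmxA mulmxtVK //.
  by rewrite mxE; apply: eq_bigr => j _; rewrite !mxE normCK.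
have vv : \sum_j `|x 0 j| ^+ 2 = \sum_j `|y 0 j| ^+ 2.
  have h1 := nx x P uP; have h2 := nx y Q uQ; rewrite -vQ in h2.
  exact: etrans (esym h1) h2.
have vv' : \sum_j `|v 0 j| ^+ 2 = \sum_j `|x 0 j| ^+ 2.
  transitivity ((v *m v ^t*) 0 0); last exact: (nx x P uP).
  by rewrite [RHS]mxE; apply: eq_bigr => j _; rewrite !mxE normCK.
have vform (w : 'rV[R[i]]_n) (U : 'M_n) (l : 'I_n -> R) : U \is unitarymx ->
    ((w *m U) *m (U ^t* *m diag_mx (\row_i (l i)%:C) *m U) *m (w *m U) ^t*) 0 0
    = \sum_j (l j)%:C * `|w 0 j| ^+ 2.
  move=> uU; rewrite -diag_form trmx_mul map_mxM !mulmxA !mulmxtVK //.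
have formA : (v *m A *m v ^t*) 0 0 = \sum_j (lam j)%:C * `|x 0 j| ^+ 2.
  by rewrite eA; exact: (vform x P lam uP).
have formB : (v *m B *m v ^t*) 0 0 = \sum_j (mu j)%:C * `|y 0 j| ^+ 2.
  by rewrite vQ eB; exact: (vform y Q mu uQ).
set Nv := \sum_j `|x 0 j| ^+ 2 in vv vv' *.
have Nv_gt0 : 0 < Nv.
  rewrite lt_def sumr_ge0 ?andbT => [|j _]; last by rewrite exprn_ge0.
  apply: contraNneq x0 => /eqP; rewrite psumr_eq0 => [/allP h|j _]; last by rewrite exprn_ge0.
  apply/eqP/rowP => j; rewrite mxE; apply/eqP; rewrite -normr_eq0.
  by have := h j; rewrite mem_index_enum expf_eq0 => /(_ isT).
have lo : (lam i)%:C * Nv <= (v *m A *m v ^t*) 0 0.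
  rewrite formA mulr_sumr; apply: ler_sum => j _.
  have [ji|ij] := ltnP j i; first by rewrite xlow // normr0 expr0n !mulr0.
  by rewrite ler_wpM2r ?exprn_ge0 // lecR lam_mono.
have hi : (v *m B *m v ^t*) 0 0 <= (mu i)%:C * Nv.
  rewrite formB vv mulr_sumr; apply: ler_sum => j _.
  have [ij|ji] := ltnP i j; first by rewrite yhigh // normr0 expr0n !mulr0.
  by rewrite ler_wpM2r ?exprn_ge0 // lecR mu_mono.
have realform (l : 'I_n -> R) (w : 'rV[R[i]]_n) :
    \sum_j (l j)%:C * `|w 0 j| ^+ 2 \is Num.real.
  apply: sum_real => j _; rewrite rpredM ?rpredX ?normr_real //.
  by apply/complex_realP; exists (l j).
have dif : (v *m A *m v ^t*) 0 0 - (v *m B *m v ^t*) 0 0 <= (n%:R * e)%:C * Nv.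
  apply: (@le_trans _ _ `|(v *m (A - B) *m v ^t*) 0 0|).
    have -> : (v *m (A - B) *m v ^t*) 0 0
        = (v *m A *m v ^t*) 0 0 - (v *m B *m v ^t*) 0 0.
      by rewrite mulmxBr mulmxBl [LHS]mxE [(- (v *m B *m v ^t*)) 0 0]mxE.
    rewrite real_ler_norm // rpredB //.
      by rewrite formA.
    by rewrite formB.
  by rewrite -vv'; apply: mx_form_le => a b; rewrite !mxE.
rewrite -lecR rmorphD /= -(ler_pM2r Nv_gt0) mulrDl.
apply: le_trans lo _; rewrite -lerBlDl.
by apply: le_trans dif; rewrite lerB.
Qed.

(** Weyl's inequality for A against itself with e = 0, in both directions. *)
Lemma sorted_eigenvalues_unique A lam mu (i : 'I_n) : A ^t* = A ->
  sorted_eigenvalues A lam -> sorted_eigenvalues A mu -> lam i = mu i.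
Proof.
move=> hA sl sm; apply/le_anti/andP.
have h a b : `|A a b - A a b| <= (0 : R)%:C by rewrite subrr normr0.
have := weyl_inequality i hA hA sl sm h; have := weyl_inequality i hA hA sm sl h.
by rewrite !mulr0 !addr0.
Qed.

End Weyl.

(** * Laurent polynomials supported in a diamond *)

Section Diamond.
Local Open Scope complex_scope.

Lemma normc_exprz (R : rcfType) (x : R[i]) (n : int) :
  Normc.normc (x ^ n) = Normc.normc x ^ n.
Proof.
have nX k : Normc.normc (x ^+ k) = Normc.normc x ^+ k.
  elim: k => [|k IH]; first by rewrite !expr0 Normc.normc1.
  by rewrite !exprS Normc.normcM IH.
by case: n => k; rewrite ?NegzE -?exprnP -?exprnN ?Normc.normcV nX.
Qed.

Lemma ler_normc_sum (R : rcfType) (T : finType) (P : pred T) (f : T -> R[i]) :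
  Normc.normc (\sum_(t | P t) f t) <= \sum_(t | P t) Normc.normc (f t).
Proof.
apply: (big_ind2 (fun x y => Normc.normc x <= y)) => //.
  by rewrite Normc.normc0.
move=> x x' y y' h h'; apply: le_trans (le_normcD _ _) _; exact: lerD.
Qed.

Lemma exprz_le_absz (R : realFieldType) (r mu : R) (n : int) :
  0 < r -> r <= mu -> r^-1 <= mu -> r ^ n <= mu ^+ `|n|.
Proof.
move=> r0 h h'; case: n => k; first by rewrite -exprnP lerXn2r ?nnegrE ?(ltW r0) // (le_trans _ h) // ltW.
rewrite NegzE -exprnN abszN -exprVn lerXn2r ?nnegrE ?invr_ge0 ?(ltW r0) //.
by rewrite (le_trans _ h) // ltW.
Qed.

Section DiamondPolynomial.
Variables (R : rcfType) (T : finType) (q1 q2 : nat).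
Variables (c : T -> R) (I J : T -> int) (tR tL tU tD : T).
Let vs := [:: tR; tL; tU; tD].
Hypotheses (q1_gt0 : (0 < q1)%N) (q2_gt0 : (0 < q2)%N).
Hypothesis vs_uniq : uniq vs.
Hypothesis c_vs : forall t, t \in vs -> `|c t| = 1.
Hypotheses (IR : I tR = q2) (JR : J tR = 0) (IL : I tL = - q2%:Z) (JL : J tL = 0).
Hypotheses (IU : I tU = 0) (JU : J tU = q1) (ID : I tD = 0) (JD : J tD = - q1%:Z).
Hypothesis inner : forall t, c t != 0 -> t \notin vs ->
  (q1 * `|I t| + q2 * `|J t| < q1 * q2)%N.

(** Exponents after multiplication by x^q2 y^q1. They are nonnegative when [c t != 0], by
    [diamond_bounds]; otherwise the value of [absz] is multiplied by a zero coefficient. *)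
Let il t := absz (I t + q2%:Z).
Let jl t := absz (J t + q1%:Z).

Definition diamond_poly : {poly {poly R[i]}} :=
  \sum_t ((c t)%:C *: 'X^(jl t))%:P * 'X^(il t).

Let F := diamond_poly.

Lemma diamond_split (V : zmodType) (G : T -> V) :
  \sum_t G t = G tR + G tL + G tU + G tD + \sum_(t | t \notin vs) G t.
Proof.
rewrite (bigID (mem vs)) /= -big_uniq //=; congr (_ + _).
by rewrite !big_cons big_nil addr0 !addrA.
Qed.

Lemma diamond_bounds t : c t != 0 -> (`|I t| <= q2)%N /\ (`|J t| <= q1)%N.
Proof.
move=> ct; have [|nt] := boolP (t \in vs).
  rewrite !inE => /or4P[] /eqP ->;
  by rewrite ?IR ?IL ?IU ?ID ?JR ?JL ?JU ?JD ?abszN ?absz_nat ?absz0.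
have := inner ct nt; split; rewrite leqNgt; apply/negP => h; nia.
Qed.

Lemma coef_diamond i :
  F`_i = \sum_t ((c t)%:C *: 'X^(jl t)) *+ (il t == i).
Proof.
rewrite coef_sum; apply: eq_bigr => t _.
by rewrite coefCM coefXn eq_sym mulr_natr.
Qed.

Lemma size_coef_diamond i : (size (F`_i)%R <= (2 * q1).+1)%N.
Proof.
rewrite coef_diamond; apply: (leq_trans (size_sum _ _ _)).
apply/bigmax_leqP => t _; have [->|ct] := eqVneq (c t) 0.
  by rewrite scale0r mul0rn size_poly0.
case: (il t == i); last by rewrite size_poly0.
rewrite mulr1n; apply: (leq_trans (size_scale_leq _ _)).
rewrite size_polyXn ltnS /jl.
have [_] := diamond_bounds ct; lia.
Qed.

(** An inner point satisfies q1 |I| < q1 q2 strictly, so the right vertex alone reaches the top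
    exponent in x. *)
Lemma il_tR t : c t != 0 -> (il t == 2 * q2)%N = (t == tR).
Proof.
move=> ct; apply/eqP/eqP => [|->]; last by rewrite /il IR; lia.
have [bI _] := diamond_bounds ct; rewrite /il => h.
have It : I t = q2 by lia.
have [|nt] := boolP (t \in vs).
  rewrite !inE => /or4P[] /eqP // e; rewrite e ?IL ?IU ?ID in It; lia.
have := inner ct nt; rewrite It; nia.
Qed.

Lemma lead_diamond : F`_(2 * q2) = (c tR)%:C *: 'X^q1.
Proof.
rewrite coef_diamond (bigD1 tR) //= big1 => [|t nt].
  have ctR : c tR != 0 by rewrite -normr_eq0 c_vs ?inE ?eqxx // oner_eq0.
  by rewrite addr0 il_tR // eqxx /jl JR add0r.
have [->|ct] := eqVneq (c t) 0; first by rewrite scale0r mul0rn.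
by rewrite il_tR // (negPf nt).
Qed.

Lemma il_tL t : c t != 0 -> (il t == 0)%N = (t == tL).
Proof.
move=> ct; apply/eqP/eqP => [|->]; last by rewrite /il IL; lia.
have [bI _] := diamond_bounds ct; rewrite /il => h.
have It : I t = - q2%:Z by lia.
have [|nt] := boolP (t \in vs).
  rewrite !inE => /or4P[] /eqP // e; rewrite e ?IR ?IU ?ID in It; lia.
have := inner ct nt; rewrite It; nia.
Qed.

Lemma coef0_diamond : F`_0 = (c tL)%:C *: 'X^q1.
Proof.
rewrite coef_diamond (bigD1 tL) //= big1 => [|t nt].
  have ctL : c tL != 0 by rewrite -normr_eq0 c_vs ?inE ?eqxx ?orbT // oner_eq0.
  by rewrite addr0 il_tL // eqxx /jl JL add0r.
have [->|ct] := eqVneq (c t) 0; first by rewrite scale0r mul0rn.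
by rewrite il_tL // (negPf nt).
Qed.

Lemma size_diamond : size F = (2 * q2).+1.
Proof.
have ctR : c tR != 0 by rewrite -normr_eq0 c_vs ?inE ?eqxx // oner_eq0.
apply/eqP; rewrite eqn_leq; apply/andP; split; last first.
  rewrite ltnNge; apply/negP => /leq_sizeP /(_ _ (leqnn _)) /eqP.
  rewrite lead_diamond scaler_eq0 (fmorph_eq0 (real_complex R)) (negPf ctR) /=.
  by rewrite -size_poly_eq0 size_polyXn.
apply/leq_sizeP => i lti; rewrite coef_diamond big1 // => t _.
have [->|ct] := eqVneq (c t) 0; first by rewrite scale0r mul0rn.
case: eqP => // ei; have [] := diamond_bounds ct; move: ei; rewrite /il; lia.
Qed.

Lemma diamond_horner (x y : R[i]) : x != 0 -> y != 0 ->
  F.[x%:P].[y] = x ^+ q2 * y ^+ q1 * \sum_t (c t)%:C * x ^ I t * y ^ J t.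
Proof.
move=> x0 y0; rewrite /F /diamond_poly !horner_sum mulr_sumr.
apply: eq_bigr => t _; have [->|ct] := eqVneq (c t) 0.
  by rewrite scale0r !mul0r mulr0 hornerE /= hornerE.
have [bI bJ] := diamond_bounds ct.
rewrite hornerM hornerC hornerXn hornerM -polyC_exp hornerC hornerZ hornerXn.
have -> : x ^+ il t = x ^+ q2 * x ^ I t.
  by rewrite !exprnP -expfzDr // /il; congr (_ ^ _); lia.
have -> : y ^+ jl t = y ^+ q1 * y ^ J t.
  by rewrite !exprnP -expfzDr // /jl; congr (_ ^ _); lia.
ring.
Qed.

(** The Euler operator x d/dx multiplies the term of index t by q2 + I t. Hence, at a zero of F off
    the axes, F' vanishes exactly when the logarithmic derivative of the Laurent polynomial does. *)
Lemma diamond_deriv_horner (x y : R[i]) : x != 0 -> y != 0 ->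
  x * F^`().[x%:P].[y] = q2%:R * F.[x%:P].[y]
    + x ^+ q2 * y ^+ q1 * \sum_t (c t)%:C * (I t)%:~R * x ^ I t * y ^ J t.
Proof.
move=> x0 y0; rewrite diamond_horner // mulrCA -mulrDr mulr_sumr -big_split /=.
rewrite /F /diamond_poly raddf_sum /= !horner_sum !mulr_sumr.
apply: eq_bigr => t _; have [->|ct] := eqVneq (c t) 0.
  by rewrite scale0r polyC0 !mul0r deriv0 !horner0 !mulr0 addr0 mulr0.
have [bI bJ] := diamond_bounds ct.
rewrite derivM derivC mul0r add0r derivXn hornerM hornerC hornerMn hornerXn.
rewrite hornerM hornerMn -polyC_exp hornerC hornerZ hornerXn.
have eI : x * x ^+ (il t).-1 *+ il t = (q2%:R + (I t)%:~R) * (x ^+ q2 * x ^ I t).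
  have -> : q2%:R + (I t)%:~R = (il t)%:R :> R[i].
    by rewrite -[q2%:R]mulrz_nat -[(il t)%:R]mulrz_nat -intrD /il; congr (_ %:~R); lia.
  have -> : x ^+ q2 * x ^ I t = x ^+ il t.
    by rewrite !exprnP -expfzDr // /il; congr (_ ^ _); lia.
  (* At [il t = 0] the predecessor is truncated, but both sides are zero. *)
  case: (il t) => [|k]; first by rewrite mulr0n mul0r.
  by rewrite -exprS mulr_natl.
have -> : y ^+ jl t = y ^+ q1 * y ^ J t.
  by rewrite !exprnP -expfzDr // /jl; congr (_ ^ _); lia.
rewrite -mulrnAr in eI.
transitivity ((c t)%:C * (y ^+ q1 * y ^ J t) * (x * (x ^+ (il t).-1 *+ il t))); first by ring.
rewrite eI; ring.
Qed.

(* On the curve, the three quantities [|s|^Q], [|s|^-Q], [b^Q] bound each other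
   up to lower order terms, so a critical point over [y = b^q2] forces [b] to be
   bounded. *)
Lemma diamond_no_critical_point (s : R[i]) (b : R) : s != 0 -> 1 <= b ->
  \sum_t (c t)%:C * (s ^+ q1) ^ I t * (b ^+ q2)%:C ^ J t = 0 ->
  \sum_t (c t)%:C * (I t)%:~R * (s ^+ q1) ^ I t * (b ^+ q2)%:C ^ J t = 0 ->
  b <= 3 * (1 + \sum_t `|c t|).
Proof.
move=> s0 b1; pose N := @Normc.normc R.
pose w t := (s ^+ q1) ^ I t * (b ^+ q2)%:C ^ J t.
under eq_bigr do rewrite -mulrA -/(w _).
under [X in _ -> X = 0 -> _]eq_bigr do rewrite -mulrA -/(w _).
move=> P0 DP0; rewrite diamond_split in P0.
rewrite diamond_split IR IL IU ID mulr0z !mulr0 !mul0r !addr0 in DP0.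
have N0 (z : R[i]) : 0 <= N z by rewrite /N; case: (z) => ? ?; exact: sqrtr_ge0.
have NC (a : R) : N a%:C = `|a| by rewrite /N /= expr0n addr0 sqrtr_sqr.
have r0 : 0 < N s.
  by rewrite lt_def N0 andbT; apply: contra_neq s0; exact: Normc.eq0_normc.
set r := N s in r0; have b0 : 0 < b := lt_le_trans ltr01 b1.
have NX z k : N (z ^+ k) = N z ^+ k by rewrite exprnP /N normc_exprz.
have Nw t : N (w t) = r ^ (q1%:Z * I t) * b ^ (q2%:Z * J t).
  rewrite /w /N Normc.normcM !normc_exprz -/N NX NC.
  by rewrite ger0_norm ?exprn_ge0 ?ltW // !exprnP !exprz_exp.
(* With x = s^q1 and y = b^q2 the vertex terms are Q-th powers of r, 1/r, b and 1/b, where Q = q1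
   q2, while every inner term is at most mu^(Q-1) by [inner]. *)
pose mu := Num.max b (Num.max r r^-1).
have bmu : b <= mu by rewrite le_max lexx.
have mu1 : 1 <= mu := le_trans b1 bmu.
have rmu : r <= mu by rewrite !le_max lexx orbT.
have rVmu : r^-1 <= mu by rewrite !le_max lexx !orbT.
pose m := mu ^+ (q1 * q2).-1.
have m1 : 1 <= m by rewrite exprn_ege1.
have winner t : c t != 0 -> t \notin vs -> N (w t) <= m.
  move=> ct nt; rewrite Nw.
  apply: (@le_trans _ _ (mu ^+ `|(q1%:Z * I t)%R| * mu ^+ `|(q2%:Z * J t)%R|)).
    by rewrite ler_pM ?exprz_ge0 ?(ltW r0) ?(ltW b0) ?exprz_le_absz // (le_trans _ mu1) // invf_le1.
  rewrite -exprD ler_weXn2l // !abszM !absz_nat.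
  by rewrite -ltnS prednK ?muln_gt0 ?q1_gt0 //; exact: inner.
pose S := \sum_t `|c t|.
have S0 : 0 <= S by apply: sumr_ge0 => t _.
have Nsum (g : T -> R[i]) k : 0 <= k -> (forall t, c t != 0 -> N (g t) <= k) ->
    N (\sum_(t | t \notin vs) (c t)%:C * g t * w t) <= k * S * m.
  move=> k0 gk; apply: le_trans (ler_normc_sum _ _) _.
  rewrite big_mkcond mulr_sumr mulr_suml; apply: ler_sum => t _.
  have km0 : 0 <= k * `|c t| * m.
    by rewrite !mulr_ge0 // (le_trans ler01).
  case: ifP => // nt; have [ct|ct] := eqVneq (c t) 0.
    by rewrite ct !mul0r Normc.normc0 normr0 mulr0 mul0r.
  rewrite Normc.normcM [X in X * _]Normc.normcM -/N NC [k * _]mulrC.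
  apply: ler_pM; [exact: mulr_ge0 | exact: N0 | | exact: winner].
  by apply: ler_wpM2l => //; exact: gk.
have NM (x y : R[i]) : N (x * y) = N x * N y by exact: Normc.normcM.
have NN (x : R[i]) : N (- x) = N x by exact: normcN.
have h1 : N (\sum_(t | t \notin vs) (c t)%:C * w t) <= S * m.
  have := Nsum (fun=> 1) 1 ler01; rewrite mul1r.
  under eq_bigr do rewrite mulr1.
  by apply=> t _; rewrite /N Normc.normc1.
(* Since |I t| <= q2, this error is q2 S m, and the factor q2 cancels against the one at the
   horizontal vertices. *)
have h2 : N (\sum_(t | t \notin vs) (c t)%:C * (I t)%:~R * w t) <= q2%:R * S * m.
  apply: Nsum => [|t ct]; first exact: ler0n.
  rewrite -(rmorph_int (real_complex R)) NC -intr_norm -natr_absz.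
  by rewrite ler_nat; have [] := diamond_bounds ct.
have cN t : t \in vs -> N (c t)%:C = 1 by move=> /c_vs; rewrite NC.
have cR : N (c tR)%:C = 1 by rewrite cN // !inE eqxx.
have cL : N (c tL)%:C = 1 by rewrite cN // !inE eqxx ?orbT.
have cU : N (c tU)%:C = 1 by rewrite cN // !inE eqxx ?orbT.
have cD : N (c tD)%:C = 1 by rewrite cN // !inE eqxx ?orbT.
have wR : N (w tR) = r ^+ (q1 * q2).
  by rewrite Nw IR JR mulr0 expr0z mulr1.
have wL : N (w tL) = r^-1 ^+ (q1 * q2).
  by rewrite Nw IL JL mulr0 expr0z mulr1 mulrN -PoszM -exprnN exprVn.
have wU : N (w tU) = b ^+ (q1 * q2).
  by rewrite Nw IU JU mulr0 expr0z mul1r mulnC.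
have wD : N (w tD) = b^-1 ^+ (q1 * q2).
  by rewrite Nw ID JD mulr0 expr0z mul1r mulrN -PoszM -exprnN exprVn mulnC.
have Nle (x y : R[i]) z : x + y = 0 -> N y <= z -> N x <= z.
  by move=> /addr0_eq <-; rewrite NN.
have ND (x y : R[i]) z z' : N x <= z -> N y <= z' -> N (x + y) <= z + z'.
  by move=> hx hy; apply: le_trans (le_normcD _ _) (lerD hx hy).
have q2R : (0 : R) < q2%:R by rewrite ltr0n.
have Nq (x y : R[i]) : N (x * q2%:~R * y) = N x * q2%:R * N y.
  rewrite !NM; congr (_ * _ * _).
  by rewrite -(rmorph_int (real_complex R)) NC ger0_norm // ler0z.
have tR' : N ((c tR)%:C * q2%:~R * w tR) = q2%:R * r ^+ (q1 * q2).
  by rewrite Nq cR wR mul1r.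
have tL' : N ((c tL)%:C * (- q2%:Z)%:~R * w tL) = q2%:R * r^-1 ^+ (q1 * q2).
  by rewrite mulrNz mulrN mulNr NN Nq cL wL mul1r.
(* The upper and lower vertices drop out of the derivative equation because I = 0 there, so r^Q and
   r^-Q differ by at most S m. *)
have AB : r ^+ (q1 * q2) <= r^-1 ^+ (q1 * q2) + S * m.
  rewrite -(ler_pM2l q2R) mulrDr mulrA -tR'.
  by move: DP0; rewrite -addrA => /Nle; apply; apply: ND => //; rewrite tL'.
have BA : r^-1 ^+ (q1 * q2) <= r ^+ (q1 * q2) + S * m.
  rewrite -(ler_pM2l q2R) mulrDr mulrA -tL'.
  move: DP0; rewrite -addrA addrCA => /Nle; apply; apply: ND => //.
  by rewrite tR'.
have ABr : r ^+ (q1 * q2) * r^-1 ^+ (q1 * q2) = 1.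
  by rewrite -exprMn divff ?expr1n ?gt_eqF.
(* Here the equation of the curve itself is solved for the upper vertex term. *)
have Zr : b ^+ (q1 * q2) <= r ^+ (q1 * q2) + r^-1 ^+ (q1 * q2) + 1 + S * m.
  rewrite -{1}wU -[X in X <= _]mul1r -{1}cU -NM.
  have {}P0 : (c tU)%:C * w tU + ((c tR)%:C * w tR + (c tL)%:C * w tL
      + (c tD)%:C * w tD + \sum_(t | t \notin vs) (c t)%:C * w t) = 0.
    by rewrite -[RHS]P0; ring.
  apply: Nle P0 _; apply: (ND) => //; apply: (ND); first apply: (ND).
  - by rewrite NM cR wR mul1r.
  - by rewrite NM cL wL mul1r.
  - by rewrite NM cD wD mul1r exprn_ile1 ?invr_ge0 ?(ltW b0) // invf_le1.
have Sm0 : 0 <= S * m by rewrite mulr_ge0 // (le_trans ler01).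
have A0 : 0 <= r ^+ (q1 * q2) by rewrite exprn_ge0 ?ltW.
have B0 : 0 <= r^-1 ^+ (q1 * q2) by rewrite exprn_ge0 ?invr_ge0 ?ltW.
(* One of r^Q and r^-Q is at most 1, so the other is at most 1 + S m. *)
have rQ_le1 : r ^+ (q1 * q2) <= 1 \/ r^-1 ^+ (q1 * q2) <= 1.
  have [r1|/ltW r1] := leP r 1; first by left; rewrite exprn_ile1 // ltW.
  by right; rewrite exprn_ile1 ?invr_ge0 ?invf_le1 ?(ltW r0).
have Am : r ^+ (q1 * q2) <= m + S * m by case: rQ_le1 => ?; lra.
have Bm : r^-1 ^+ (q1 * q2) <= m + S * m by case: rQ_le1 => ?; lra.
(* The bound on b^Q has three parts, r^Q, r^-Q and 1 + S m, each at most m + S m. Dividing by m =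
   mu^(Q-1) then bounds mu, hence b. *)
have mu_le : mu ^+ (q1 * q2) <= 3 * (1 + S) * m.
  have -> : 3 * (1 + S) * m = 3 * (m + S * m) by ring.
  have : [|| mu == b, mu == r | mu == r^-1].
    by rewrite /mu; case: (leP b); case: (leP r); rewrite ?eqxx ?orbT.
  by case/or3P => /eqP ->; lra.
apply: le_trans bmu _; rewrite -(@ler_pM2r _ m) ?(lt_le_trans ltr01) //.
by move: mu_le; rewrite -{1}(@prednK (q1 * q2)) ?muln_gt0 ?q1_gt0 // exprS.
Qed.

(** Evaluate at y = b^q2 with b just above the bound of [diamond_no_critical_point]. The leading
    coefficients survive, so the resultant specializes to that of F(., y) and its derivative, which
    is nonzero because the two have no common root. *)
Lemma diamond_resultant_neq0 : resultant F F^`() != 0.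
Proof.
pose b : R := 3 * (1 + \sum_t `|c t|) + 1; pose y := (b ^+ q2)%:C.
have S0 : 0 <= \sum_t `|c t| by apply: sumr_ge0.
have b1 : 1 <= b by rewrite /b; lra.
have y0 : y != 0.
  by rewrite /y (fmorph_eq0 (real_complex R)) expf_neq0 // gt_eqF // (lt_le_trans ltr01).
have ctR : (c tR)%:C != 0.
  by rewrite (fmorph_eq0 (real_complex R)) -normr_eq0 c_vs ?inE ?eqxx // oner_eq0.
have lF : lead_coef F = (c tR)%:C *: 'X^q1.
  by rewrite lead_coefE size_diamond lead_diamond.
have lF0 : horner_eval y (lead_coef F) != 0.
  by rewrite horner_evalE lF hornerZ hornerXn mulf_neq0 ?expf_neq0.
have q20 : (2 * q2 != 0)%N by lia.
have cF' : F^`()`_(2 * q2).-1 = lead_coef F *+ (2 * q2).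
  by rewrite coef_deriv prednK ?lt0n // lead_coefE size_diamond.
have sF' : size F^`() = (2 * q2)%N.
  apply/eqP; rewrite eqn_leq; apply/andP; split.
    rewrite -ltnS -size_diamond lt_size_deriv // -size_poly_eq0 size_diamond //.
  rewrite -[X in (X <= _)%N]prednK ?lt0n // ltnNge; apply/negP => /leq_sizeP.
  move=> /(_ _ (leqnn _)) /eqP; rewrite cF' => /eqP h; move: lF0.
  have /eqP : horner_eval y (lead_coef F *+ (2 * q2)) = 0 by rewrite h rmorph0.
  by rewrite rmorphMn mulrn_eq0 (negPf q20) /= => ->.
have lF'0 : horner_eval y (lead_coef F^`()) != 0.
  by rewrite lead_coefE sF' cF' rmorphMn mulrn_eq0 negb_or q20.
suff : horner_eval y (resultant F F^`()) != 0.
  by apply: contra_neq => ->; rewrite rmorph0.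
rewrite map_resultant // resultant_eq0 -leqNgt.
have Fy0 : map_poly (horner_eval y) F != 0.
  by apply: contraNneq lF0 => /polyP /(_ (size F).-1); rewrite coef_map coef0 => /eqP.
suff : coprimep (map_poly (horner_eval y) F) (map_poly (horner_eval y) F^`()).
  by rewrite coprimep_def => /eqP ->.
apply/Pdiv.ClosedField.coprimepP => x; rewrite /root !horner_map_eval => /eqP Fx0.
(* The root 0 is excluded because the constant coefficient in x is the nonzero monomial of the left
   vertex. *)
have [x0|x0] := eqVneq x 0.
  exfalso; move: Fx0; rewrite x0 polyC0 horner_coef0 coef0_diamond hornerZ hornerXn.
  apply/eqP; rewrite mulf_neq0 ?expf_neq0 // (fmorph_eq0 (real_complex R)).
  by rewrite -normr_eq0 c_vs ?inE ?eqxx ?orbT // oner_eq0.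
apply/eqP => F'x0; have sx := rootCK q1_gt0 x; set s := q1.-root x in sx.
have s0 : s != 0 by apply: contra_neq x0 => s0; rewrite -sx s0 expr0n gtn_eqF.
have xy0 : x ^+ q2 * y ^+ q1 != 0 by rewrite mulf_neq0 ?expf_neq0.
have := diamond_no_critical_point s0 b1; rewrite sx -/y.
have -> : b <= 3 * (1 + \sum_t `|c t|) = false by apply/negbTE; rewrite -ltNge /b; lra.
move: (diamond_deriv_horner x0 y0) (diamond_horner x0 y0).
rewrite F'x0 Fx0 !mulr0 add0r => /esym/eqP; rewrite mulf_eq0 (negPf xy0) /= => /eqP DP0.
move=> /esym/eqP; rewrite mulf_eq0 (negPf xy0) /= => /eqP P0.
by move=> /(_ P0 DP0).
Qed.

(** F and F' have degrees 2 q2 and at most 2 q2 - 1 in x, with coefficients of degree at most 2 q1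
    in y. The top coefficient of F is a monomial in y, so F(., y) is a nonzero polynomial for y !=
    0. *)
Lemma diamond_critical_points_bound (s : seq (R[i] * R[i])) : uniq s ->
  (forall z, z \in s -> [/\ z.1 != 0, z.2 != 0,
     \sum_t (c t)%:C * z.1 ^ I t * z.2 ^ J t = 0 &
     \sum_t (c t)%:C * (I t)%:~R * z.1 ^ I t * z.2 ^ J t = 0]) ->
  (size s <= (2 * q2).-1 * (2 * q1) + 2 * q2 * (2 * q1))%N.
Proof.
move=> us hs.
have F'b i : (size (F^`()`_i)%R <= (2 * q1).+1)%N.
  by rewrite coef_deriv (leq_trans _ (size_coef_diamond i.+1)) // -scaler_nat size_scale_leq.
have sF' : ((size F^`()).-1 <= (2 * q2).-1)%N.
  have F0 : F != 0 by rewrite -size_poly_eq0 size_diamond.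
  have := lt_size_deriv F0; rewrite size_diamond; lia.
have := common_zeros_bound size_coef_diamond F'b diamond_resultant_neq0 us.
rewrite size_diamond => h; apply: leq_trans (h _) _; last first.
  by rewrite leq_add2r leq_mul2r sF' orbT.
move=> z /hs[x0 y0 P0 DP0].
have Fz : F.[z.1%:P].[z.2] = 0 by rewrite diamond_horner // P0 mulr0.
split => //; last first.
  by apply: (mulfI x0); rewrite diamond_deriv_horner // Fz DP0 !mulr0 addr0.
apply/eqP => /polyP /(_ (2 * q2)%N); rewrite coef_map coef0 lead_diamond.
rewrite /= /horner_eval hornerZ hornerXn => /eqP.
rewrite mulf_eq0 (fmorph_eq0 (real_complex R)) expf_eq0 (negPf y0) andbF orbF.
by rewrite -normr_eq0 c_vs ?inE ?eqxx // oner_eq0.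
Qed.
End DiamondPolynomial.

End Diamond.

(** * Expansion of the Floquet determinant *)

(** Multilinearity in the rows: [f] records which summand is chosen in each row. *)
Lemma det_sum_rows (K : comNzRingType) n (D : finType) (w : 'I_n -> D -> K)
    (h : 'I_n -> D -> 'I_n -> K) :
  \det (\matrix_(a, b) \sum_o w a o * h a o b) =
  \sum_(f : {ffun 'I_n -> D})
    (\prod_a w a (f a)) * \det (\matrix_(a, b) h a (f a) b).
Proof.
rewrite /determinant; under [RHS]eq_bigr do rewrite mulr_sumr.
rewrite exchange_big /=; apply: eq_bigr => s _.
under eq_bigr do rewrite mxE.
rewrite bigA_distr_bigA mulr_sumr; apply: eq_bigr => f _.
rewrite big_split /= mulrCA; congr (_ * (_ * _)).
by apply: eq_bigr => a _; rewrite mxE.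
Qed.

Lemma det_neq0_perm (K : comNzRingType) n (M : 'M[K]_n) :
  \det M != 0 -> exists s : {perm 'I_n}, forall a, M a (s a) != 0.
Proof.
move=> dM; have [[s /forallP hs]|] := pselect (exists s : {perm 'I_n}, [forall a, M a (s a) != 0]).
  by exists s.
move=> no; case/eqP: dM; rewrite /determinant big1 // => s _.
have : ~~ [forall a, M a (s a) != 0] by apply/negP => h; apply: no; exists s.
rewrite negb_forall => /existsP[a]; rewrite negbK => /eqP Ma.
by rewrite (bigD1 a) //= Ma mul0r mulr0.
Qed.

Lemma dvdz_ord q (i j : 'I_q) : (q%:Z %| i%:Z - j%:Z)%Z = (i == j).
Proof.
rewrite -eqz_mod_dvd !modz_small ?le0z_nat ?ltz_nat ?ltn_ord //.
Qed.

Lemma dvdzB (d m n : int) : (d %| m)%Z -> (d %| n)%Z -> (d %| m - n)%Z.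
Proof. by move=> /dvdzP[k ->] /dvdzP[l ->]; rewrite -mulrBl dvdz_mull. Qed.

Lemma leq_absz_sum (T : finType) (g : T -> int) :
  (`|(\sum_t g t)%R| <= \sum_t `|g t|)%N.
Proof.
apply: (big_ind2 (fun (x : int) (y : nat) => (`|x| <= y)%N)) => //.
by move=> x y x' y'; lia.
Qed.

Section Expansion.
Local Open Scope complex_scope.
Variables (q1 q2 : nat).
Hypotheses (q1_gt0 : (0 < q1)%N) (q2_gt0 : (0 < q2)%N).
Local Notation N := (q1 * q2)%N.
Implicit Types (a b : 'I_N) (o : 'I_5) (f : {ffun 'I_N -> 'I_5}).

(* [0, 1, 2, 3, 4] encode: right, left, up, down, stay. *)
Definition step1 (o : 'I_5) : int :=
  match nat_of_ord o with 0 => 1 | 1 => -1 | _ => 0 end.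
Definition step2 (o : 'I_5) : int :=
  match nat_of_ord o with 2 => 1 | 3 => -1 | _ => 0 end.

(** Coordinates start at 0 here, unlike in [fl_site], so that floor division by the period counts
    crossings of the cell boundary. *)
Definition pos1 a : int := (fl_coord a).1 : nat.
Definition pos2 a : int := (fl_coord a).2 : nat.

Definition hit a o b : bool :=
  (q1%:Z %| pos1 a + step1 o - pos1 b)%Z && (q2%:Z %| pos2 a + step2 o - pos2 b)%Z.

(** Exponent of the Bloch phase acquired by the move [o] from [a]. *)
Definition wind1 a o : int := ((pos1 a + step1 o) %/ q1%:Z)%Z.
Definition wind2 a o : int := ((pos2 a + step2 o) %/ q2%:Z)%Z.

Definition winding1 f : int := \sum_a wind1 a (f a).
Definition winding2 f : int := \sum_a wind2 a (f a).

Lemma fl_coord_inj : injective (@fl_coord q1 q2).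
Proof. by move=> a b /enum_val_inj /cast_ord_inj. Qed.

Lemma pos1_range a : 0 <= pos1 a < q1.
Proof. by rewrite /pos1 le0z_nat ltz_nat ltn_ord. Qed.

Lemma pos2_range a : 0 <= pos2 a < q2.
Proof. by rewrite /pos2 le0z_nat ltz_nat ltn_ord. Qed.

Lemma hit_wind a o b : hit a o b ->
  pos1 a + step1 o = wind1 a o * q1 + pos1 b /\
  pos2 a + step2 o = wind2 a o * q2 + pos2 b.
Proof.
have divE (q : nat) (x r : int) : (0 < q)%N -> 0 <= r < q -> (q %| x - r)%Z ->
    x = (x %/ q)%Z * q + r.
  move=> q0 rq /dvdzP[k e].
  have -> : x = k * q + r by rewrite -e subrK.
  have q_neq0 : q%:Z != 0 by lia.
  by rewrite divzMDl // divz_small ?addr0.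
case/andP => h1 h2; split; apply: divE => //; [exact: pos1_range|exact: pos2_range].
Qed.

Lemma hit_stay a b : hit a (inord 4) b = (a == b).
Proof.
rewrite /hit /step1 /step2 inordK //= !addr0 !dvdz_ord.
by rewrite -(inj_eq fl_coord_inj) [RHS]/eq_op.
Qed.

Lemma hit_inj a a' o b : hit a o b -> hit a' o b -> a = a'.
Proof.
move=> /andP[h1 h2] /andP[h1' h2']; apply: fl_coord_inj.
have := dvdzB h1 h1'; have := dvdzB h2 h2'.
have -> : pos2 a + step2 o - pos2 b - (pos2 a' + step2 o - pos2 b) = pos2 a - pos2 a'.
  by ring.
have -> : pos1 a + step1 o - pos1 b - (pos1 a' + step1 o - pos1 b) = pos1 a - pos1 a'.
  by ring.
rewrite !dvdz_ord => /eqP e2 /eqP e1.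
by rewrite [fl_coord a]surjective_pairing e1 e2 -surjective_pairing.
Qed.

Lemma hit_ex a o : exists b, hit a o b.
Proof.
have ord_of (q : nat) (x : int) : (0 < q)%N -> exists i : 'I_q, (q%:Z %| x - i%:Z)%Z.
  move=> q0; have lt : (`|(x %% q)%Z| < q)%N.
    by have := ltz_pmod x (d := q); have := modz_ge0 x (d := q); lia.
  have e : (x %% q)%Z = `|(x %% q)%Z|%N by have := modz_ge0 x (d := q); lia.
  by exists (Ordinal lt); rewrite /= -e {1}(divz_eq x q) addrK dvdz_mull.
have [i1 h1] := ord_of q1 (pos1 a + step1 o) q1_gt0.
have [i2 h2] := ord_of q2 (pos2 a + step2 o) q2_gt0.
exists (cast_ord (mxvec_cast q1 q2) (enum_rank (i1, i2))).
by rewrite /hit /pos1 /pos2 /fl_coord cast_ordK enum_rankK h1 h2.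
Qed.

(** The same move made at every site is a translation of the torus of sites. *)
Lemma hit_perm o : exists s : {perm 'I_N}, forall a b, hit a o b = (s a == b).
Proof.
pose t a := xchoose (hit_ex a o).
have ht a : hit a o (t a) := xchooseP (hit_ex a o).
have t_inj : injective t.
  by move=> a a' e; apply: (hit_inj (ht a)); rewrite e; exact: ht.
exists (perm t_inj) => a b; rewrite permE; apply/idP/eqP => [h|<- //].
have /andP[h1 h2] := ht a; have /andP[h1' h2'] := h; apply: fl_coord_inj.
have := dvdzB h1' h1; have := dvdzB h2' h2.
have -> : pos2 a + step2 o - pos2 b - (pos2 a + step2 o - pos2 (t a)) = pos2 (t a) - pos2 b.
  by ring.
have -> : pos1 a + step1 o - pos1 b - (pos1 a + step1 o - pos1 (t a)) = pos1 (t a) - pos1 b.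
  by ring.
rewrite !dvdz_ord => /eqP e2 /eqP e1.
by rewrite [fl_coord (t a)]surjective_pairing e1 e2 -surjective_pairing.
Qed.

(** Sum [hit_wind] over all sites: as [s] is a permutation, the positions cancel and only steps and
    windings remain. *)
Lemma winding_steps f (s : {perm 'I_N}) : (forall a, hit a (f a) (s a)) ->
  q1%:Z * winding1 f = \sum_a step1 (f a) /\
  q2%:Z * winding2 f = \sum_a step2 (f a).
Proof.
move=> hs; split.
  apply: (addrI (\sum_a pos1 a)); rewrite -big_split /=.
  under [RHS]eq_bigr => a _ do rewrite (hit_wind (hs a)).1.
  rewrite big_split /= addrC -mulr_suml mulrC; congr (_ + _).
  by rewrite (reindex_inj (@perm_inj _ s)).
apply: (addrI (\sum_a pos2 a)); rewrite -big_split /=.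
under [RHS]eq_bigr => a _ do rewrite (hit_wind (hs a)).2.
rewrite big_split /= addrC -mulr_suml mulrC; congr (_ + _).
by rewrite (reindex_inj (@perm_inj _ s)).
Qed.

(** N terms, each at most 1, can only reach the sum N if all equal 1, which forces the direction [o]
    everywhere. *)
Lemma const_of_sum_step (g : 'I_5 -> int) (o : 'I_5) f :
  (forall o', g o' <= 1) -> (forall o', g o' = 1 -> o' = o) ->
  N%:Z <= \sum_a g (f a) -> f = [ffun=> o].
Proof.
move=> g1 go hN; apply/ffunP => a; rewrite ffunE; apply: go.
apply/eqP; rewrite eq_le g1 /= leNgt; apply/negP => lt.
have : \sum_a g (f a) < \sum_(a < N) 1 :> int.
  rewrite (bigD1 a) //= [X in _ < X](bigD1 a) //=.
  by rewrite ltr_leD // ler_sum.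
by rewrite sumr_const card_ord natz ltNge hN.
Qed.

(** Each site contributes at most one unit step, whence the weak inequality. A nonconstant choice
    gives |I| < q2 and |J| < q1; under equality, coprimality makes q1 divide |J|, so J = 0 and |I| =
    q2, a contradiction. *)
Lemma inner_winding f (s : {perm 'I_N}) : coprime q1 q2 ->
  (forall a, hit a (f a) (s a)) ->
  (forall o : 'I_5, (o < 4)%N -> f != [ffun=> o]) ->
  (q1 * `|winding1 f| + q2 * `|winding2 f| < q1 * q2)%N.
Proof.
move=> cop hs nconst; have [w1 w2] := winding_steps hs.
set I := winding1 f in w1 *; set J := winding2 f in w2 *.
have stepb (o : 'I_5) : (`|step1 o| + `|step2 o| <= 1)%N.
  by case: o => [[|[|[|[|[]]]]]].
have le_tot : (q1 * `|I| + q2 * `|J| <= q1 * q2)%N.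
  have -> : (q1 * `|I| = `|(\sum_a step1 (f a))%R|)%N by rewrite -w1 abszM.
  have -> : (q2 * `|J| = `|(\sum_a step2 (f a))%R|)%N by rewrite -w2 abszM.
  apply: (@leq_trans (\sum_a (`|step1 (f a)| + `|step2 (f a)|))).
    by rewrite big_split leq_add // leq_absz_sum.
  by rewrite -[leqRHS]card_ord -sum1_card; apply: leq_sum.
have no_const (g : 'I_5 -> int) (o : 'I_5) : (o < 4)%N ->
    (forall o', g o' <= 1) -> (forall o', g o' = 1 -> o' = o) ->
    \sum_a g (f a) < N%:Z.
  move=> o4 g1 go; rewrite ltNge; apply/negP => /(const_of_sum_step g1 go) e.
  by have := nconst o o4; rewrite e eqxx.
have b1 := no_const step1 (inord 0); have b2 := no_const (fun o => - step1 o) (inord 1).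
have b3 := no_const step2 (inord 2); have b4 := no_const (fun o => - step2 o) (inord 3).
rewrite !sumrN !inordK // in b1 b2 b3 b4.
have {}b1 : \sum_a step1 (f a) < N.
  by apply: b1 => // -[[|[|[|[|[|[]]]]]] ? //= _]; apply: val_inj; rewrite /= inordK.
have {}b2 : - (\sum_a step1 (f a)) < N.
  by apply: b2 => // -[[|[|[|[|[|[]]]]]] ? //= _]; apply: val_inj; rewrite /= inordK.
have {}b3 : \sum_a step2 (f a) < N.
  by apply: b3 => // -[[|[|[|[|[|[]]]]]] ? //= _]; apply: val_inj; rewrite /= inordK.
have {}b4 : - (\sum_a step2 (f a)) < N.
  by apply: b4 => // -[[|[|[|[|[|[]]]]]] ? //= _]; apply: val_inj; rewrite /= inordK.
have I_lt : (`|I| < q2)%N.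
  by rewrite -(ltn_pmul2l q1_gt0) -{1}(absz_nat q1) -abszM w1; lia.
have J_lt : (`|J| < q1)%N.
  by rewrite -(ltn_pmul2l q2_gt0) -{1}(absz_nat q2) -abszM w2 [X in (_ < X)%N]mulnC; lia.
rewrite ltn_neqAle le_tot andbT; apply/eqP => e.
have : (q1 %| q2 * `|J|)%N.
  by rewrite -(dvdn_addr _ (dvdn_mulr `|I| (dvdnn q1))) e dvdn_mulr.
rewrite Gauss_dvdr // => /dvdnP[k eJ].
have k0 : k = 0 by case: k eJ => // k; rewrite mulSn; lia.
by move: e; rewrite eJ k0 mul0n muln0 addn0 => /eqP; rewrite eqn_pmul2l // => /eqP; lia.
Qed.

Definition opp_dir (o : 'I_5) : 'I_5 :=
  inord (match nat_of_ord o with 0 => 1 | 1 => 0 | 2 => 3 | 3 => 2 | k => k end).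

Lemma opp_dirK : involutive opp_dir.
Proof.
by case=> [[|[|[|[|[|k]]]]] lt] //; apply: val_inj; rewrite /opp_dir /= !inordK.
Qed.

Lemma step_opp o : step1 (opp_dir o) = - step1 o /\ step2 (opp_dir o) = - step2 o.
Proof.
by case: o => [[|[|[|[|[|k]]]]] lt] //; rewrite /opp_dir /step1 /step2 /= inordK.
Qed.

Lemma hit_opp a o b : hit a (opp_dir o) b = hit b o a.
Proof.
have [e1 e2] := step_opp o; rewrite /hit e1 e2.
have dvdzN (d m n : int) : m = - n -> (d %| m)%Z = (d %| n)%Z.
  by move=> ->; rewrite !dvdzE abszN.
by congr (_ && _); apply: dvdzN; ring.
Qed.

(** A reversed move crosses the same boundary in the opposite sense. *)
Lemma wind_opp a o b : hit b o a ->
  wind1 a (opp_dir o) = - wind1 b o /\ wind2 a (opp_dir o) = - wind2 b o.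
Proof.
move=> h; have [h1 h2] := hit_wind h.
have [h1' h2'] : pos1 a + step1 (opp_dir o) = wind1 a (opp_dir o) * q1 + pos1 b /\
    pos2 a + step2 (opp_dir o) = wind2 a (opp_dir o) * q2 + pos2 b.
  by apply: hit_wind; rewrite hit_opp.
have [e1 e2] := step_opp o; rewrite e1 in h1'; rewrite e2 in h2'.
have q1_neq0 : q1%:Z != 0 by lia. have q2_neq0 : q2%:Z != 0 by lia.
by split; [apply: (mulIf q1_neq0)|apply: (mulIf q2_neq0)]; rewrite mulNr; lia.
Qed.

(** * Bloch matrix entries and coefficients of the determinant *)

Section Weights.
Variable R : realType.
Implicit Types (V : int * int -> R) (l k : R).

Definition dir_weight V l a o : R :=
  if o == ord_max then V (fl_site (fl_coord a)) - l else 1.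

(** The 0/1 matrix has a single 1 in each row, so its determinant is the sign of the induced
    permutation of the sites, or 0 if two sites collide. *)
Definition weight V l f : R :=
  (\prod_a dir_weight V l a (f a)) * \det (\matrix_(a, b) (hit a (f a) b)%:R).

Lemma expi2pi_neq0 (t : R) : expi2pi t != 0.
Proof.
rewrite /expi2pi eq_complex /=; apply/negP => /andP[/eqP c0 /eqP s0].
by have := cos2Dsin2 (2 * pi * t); rewrite c0 s0 expr0n addr0 => /eqP; rewrite eq_sym oner_eq0.
Qed.

Lemma conj_expi2pi (t : R) : Num.conj (expi2pi t) = (expi2pi t)^-1.
Proof.
rewrite -[LHS]/((expi2pi t)^*).
apply: (mulfI (expi2pi_neq0 t)); rewrite divff ?expi2pi_neq0 //.
rewrite /expi2pi; apply/eqP; rewrite eq_complex /= mulrN opprK -!expr2 cos2Dsin2.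
by rewrite mulrN addrC mulrC subrr !eqxx.
Qed.

Lemma schrodinger_dirs V (u : int * int -> R[i]) a :
  schrodinger V u (fl_site (fl_coord a)) =
  \sum_o (dir_weight V 0 a o)%:C * u (pos1 a + step1 o + 1, pos2 a + step2 o + 1).
Proof.
rewrite !big_ord_recl big_ord0 /schrodinger /dir_weight /step1 /step2 /= !mul1r !addr0 subr0.
by rewrite -!addrA -/(pos1 a) -/(pos2 a) ![-1 + 1]addrC.
Qed.

Lemma floquet_basis_hit k1 k2 a o b :
  floquet_basis k1 k2 (fl_coord b) (pos1 a + step1 o + 1, pos2 a + step2 o + 1) =
  expi2pi k1 ^ wind1 a o * expi2pi k2 ^ wind2 a o * (hit a o b)%:R.
Proof.
rewrite /floquet_basis /fl_site /= -/(pos1 b) -/(pos2 b).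
have -> : pos1 a + step1 o + 1 - (pos1 b + 1) = pos1 a + step1 o - pos1 b by ring.
have -> : pos2 a + step2 o + 1 - (pos2 b + 1) = pos2 a + step2 o - pos2 b by ring.
rewrite -/(hit a o b); case: (boolP (hit a o b)) => h; last by rewrite mulr0.
have [-> ->] := hit_wind h.
have q1_neq0 : q1%:Z != 0 by lia. have q2_neq0 : q2%:Z != 0 by lia.
by rewrite !addrK !mulzK // mulr1.
Qed.

Lemma DV_entry V k1 k2 a b : DV q1 q2 V k1 k2 a b =
  \sum_o (dir_weight V 0 a o)%:C * (expi2pi k1 ^ wind1 a o * expi2pi k2 ^ wind2 a o)
    * (hit a o b)%:R.
Proof.
rewrite mxE schrodinger_dirs; apply: eq_bigr => o _.
by rewrite floquet_basis_hit !mulrA.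
Qed.

Lemma DV_sub_scalar V k1 k2 l : DV q1 q2 V k1 k2 - (l%:C)%:M =
  \matrix_(a, b) \sum_o (dir_weight V l a o)%:C
    * (expi2pi k1 ^ wind1 a o * expi2pi k2 ^ wind2 a o) * (hit a o b)%:R.
Proof.
apply/matrixP => a b.
have -> : (DV q1 q2 V k1 k2 - (l%:C)%:M) a b = DV q1 q2 V k1 k2 a b - l%:C *+ (a == b).
  by rewrite !mxE.
rewrite [RHS]mxE DV_entry.
rewrite (bigD1 ord_max) //= [in RHS](bigD1 ord_max) //= addrAC; congr (_ + _); last first.
  by apply: eq_bigr => o /negPf no; rewrite /dir_weight no.
(* The scalar only enters the stay term, which carries no phase and lies on the diagonal. *)
have -> : wind1 a ord_max = 0 by rewrite /wind1 addr0 divz_small // pos1_range.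
have -> : wind2 a ord_max = 0 by rewrite /wind2 addr0 divz_small // pos2_range.
have -> : hit a ord_max b = (a == b).
  by rewrite -hit_stay; congr hit; apply: val_inj; rewrite /= inordK.
by rewrite /dir_weight eqxx subr0 !expr0z !mulr1 rmorphB /= mulrBl -[l%:C *+ _]mulr_natr.
Qed.

(** Conjugation inverts the phases, while transposition reverses the moves and so negates the
    windings. *)
Lemma DV_hermitian V k1 k2 : (map_mx Num.conj (DV q1 q2 V k1 k2)^T) = DV q1 q2 V k1 k2.
Proof.
apply/matrixP => a b; rewrite [LHS]mxE [(_^T) a b]mxE !DV_entry rmorph_sum /=.
rewrite (reindex_inj (inv_inj opp_dirK)) /=; apply: eq_bigr => o _.
rewrite hit_opp; have [h|h] := boolP (hit a o b); last by rewrite !mulr0 rmorph0.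
have [w1 w2] := wind_opp h; rewrite w1 w2 !mulr1 !rmorphM /=.
congr (_ * (_ * _)).
- have -> : dir_weight V 0 b (opp_dir o) = dir_weight V 0 a o.
    rewrite /dir_weight (_ : (opp_dir o == ord_max) = (o == ord_max)); last first.
      by rewrite -(inj_eq (inv_inj opp_dirK)) opp_dirK (_ : opp_dir ord_max = ord_max) //;
         apply: val_inj; rewrite /opp_dir /= inordK.
    (* Only the stay weight depends on the site, and a stay move forces the two sites to agree. *)
    case: eqP h => // -> h; congr (V _ - _); congr fl_site; congr fl_coord.
    by apply/esym/eqP; rewrite -hit_stay (_ : inord 4 = ord_max) //; apply: val_inj; rewrite /= inordK.
  exact: conjc_real.
- rewrite (rmorphXz Num.conj) ?unitfE ?expi2pi_neq0 //.
  by rewrite /= conj_expi2pi exprz_inv opprK.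
- rewrite (rmorphXz Num.conj) ?unitfE ?expi2pi_neq0 //.
  by rewrite /= conj_expi2pi exprz_inv opprK.
Qed.

Lemma prod_exprz (x : R[i]) (w : 'I_N -> int) : x != 0 ->
  \prod_a x ^ w a = x ^ (\sum_a w a).
Proof.
by move=> x0; symmetry; apply: (big_morph (fun n => x ^ n)) => // m n; rewrite expfzDr.
Qed.

(** For each choice [f] of directions the phases of the rows multiply to the total windings. *)
Lemma det_DV V k1 k2 l : \det (DV q1 q2 V k1 k2 - (l%:C)%:M) =
  \sum_f (weight V l f)%:C * expi2pi k1 ^ winding1 f * expi2pi k2 ^ winding2 f.
Proof.
rewrite DV_sub_scalar det_sum_rows; apply: eq_bigr => f _.
rewrite big_split /= big_split /=.
rewrite [X in _ * (X * _) * _](_ : _ = expi2pi k1 ^ winding1 f); last first.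
  exact: (prod_exprz _ (expi2pi_neq0 k1)).
rewrite [X in _ * (_ * X) * _](_ : _ = expi2pi k2 ^ winding2 f); last first.
  exact: (prod_exprz _ (expi2pi_neq0 k2)).
rewrite /weight rmorphM /= rmorph_prod -det_map_mx /=.
have -> : map_mx (real_complex R) (\matrix_(a, b) (hit a (f a) b)%:R) =
    \matrix_(a, b) (hit a (f a) b)%:R.
  by apply/matrixP => a b; rewrite !mxE rmorph_nat.
by rewrite mulrAC !mulrA.
Qed.

Lemma weight_neq0_perm V l f : weight V l f != 0 ->
  exists s : {perm 'I_N}, forall a, hit a (f a) (s a).
Proof.
rewrite mulf_eq0 negb_or => /andP[_ /det_neq0_perm[s hs]]; exists s => a.
by have := hs a; rewrite mxE; case: hit; rewrite ?eqxx.
Qed.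

Lemma weight_const V l (o : 'I_5) : (o < 4)%N -> `|weight V l [ffun=> o]| = 1.
Proof.
move=> o4; rewrite /weight big1 => [|a _]; last first.
  by rewrite /dir_weight ffunE -val_eqE /= ltn_eqF.
have [s hs] := hit_perm o.
have -> : \matrix_(a, b) (hit a ([ffun=> o] a) b)%:R = perm_mx s :> 'M[R]_N.
  by apply/matrixP => a b; rewrite !mxE ffunE hs.
by rewrite mul1r det_perm normrX normrN1 expr1n.
Qed.

End Weights.

Lemma winding_const o :
  winding1 [ffun=> o] = step1 o * q2 /\ winding2 [ffun=> o] = step2 o * q1.
Proof.
have [s hs] := hit_perm o.
have [a|w1 w2] := @winding_steps [ffun=> o] s; first by rewrite ffunE hs.
move: w1 w2; under eq_bigr do rewrite ffunE.
under [X in _ -> _ = X -> _]eq_bigr do rewrite ffunE.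
rewrite !sumr_const card_ord -[step1 o *+ _]mulr_natr -[step2 o *+ _]mulr_natr natz PoszM => w1 w2.
have q1_neq0 : q1%:Z != 0 by lia. have q2_neq0 : q2%:Z != 0 by lia.
split; first by apply: (mulfI q1_neq0); rewrite w1; ring.
by apply: (mulfI q2_neq0); rewrite w2; ring.
Qed.

End Expansion.

(** * Extrema of the band functions *)

Section Trig.
Local Open Scope complex_scope.
Variable R : realType.
Implicit Types x y t h : R.

Lemma sin_le_abs x : `|sin x| <= `|x|.
Proof.
wlog x0 : x / 0 <= x => [hw|].
  by have [/hw //|/ltW x0] := leP 0 x; rewrite -normrN -sinN -[leRHS]normrN hw ?oppr_ge0.
have [//|c _] := @MVT_segment R sin cos 0 x x0 (fun y _ => is_derive_sin y).
  by apply: continuous_subspaceT => y; exact: continuous_sin.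
rewrite sin0 !subr0 => ->; rewrite normrM ler_piMl //; exact: cos_max.
Qed.

Lemma cosB1 x : cos x - 1 = - (2 * sin (x / 2) ^+ 2).
Proof.
have -> : cos x = cos ((x / 2) *+ 2) by congr cos; field.
by rewrite cos_mulr2n cos2sin2; ring.
Qed.

Lemma norm_cosB1 x : `|cos x - 1| = 2 * `|sin (x / 2)| ^+ 2.
Proof. by rewrite cosB1 normrN normrM normrX ger0_norm. Qed.

Lemma sin_half_le x : `|sin (x / 2)| <= `|x| / 2.
Proof.
apply: le_trans (sin_le_abs _) _.
by rewrite normrM [`|2^-1|]ger0_norm ?invr_ge0.
Qed.

Lemma cosB1_le_abs x : `|cos x - 1| <= `|x|.
Proof.
rewrite norm_cosB1 expr2 mulrA -[leRHS]mulr1.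
apply: ler_pM; rewrite ?mulr_ge0 ?sin_max //.
by have := sin_half_le x; lra.
Qed.

Lemma cosB1_le_sqr x : `|cos x - 1| <= x ^+ 2.
Proof.
rewrite norm_cosB1 -(real_normK (num_real x)).
have h : `|sin (x / 2)| ^+ 2 <= (`|x| / 2) ^+ 2.
  by rewrite lerXn2r ?nnegrE ?divr_ge0 ?sin_half_le.
have := sqr_ge0 `|x|; move: h; rewrite exprMn exprVn; lra.
Qed.

Lemma sinB_le_sqr x : `|sin x - x| <= x ^+ 2.
Proof.
wlog x0 : x / 0 <= x => [hw|].
  have [/hw //|/ltW x0] := leP 0 x.
  have := hw (- x); rewrite oppr_ge0 sinN sqrrN -opprD normrN; exact.
pose f y := sin y - y.
have df y : is_derive y 1 f (cos y - 1) by apply: is_deriveB.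
have [|c /andP[c0 cx]] := @MVT_segment R f (fun y => cos y - 1) 0 x x0 (fun y _ => df y).
  apply: continuous_subspaceT => y; apply: differentiable_continuous.
  by apply/derivable1_diffP; have [] := df y.
rewrite /f sin0 !subr0 => ->; rewrite normrM expr2 -{3}(ger0_norm x0).
apply: ler_wpM2r => //; apply: le_trans (cosB1_le_abs c) _.
by move: c0 cx; rewrite !bnd_simp => c0 cx; rewrite ger0_norm.
Qed.

Lemma expi2piD x y : expi2pi (x + y) = expi2pi x * expi2pi y :> R[i].
Proof.
rewrite /expi2pi mulrDr cosD sinD; apply/eqP; rewrite eq_complex /=.
by rewrite eqxx addrC /= addrC mulrC [X in X + _]mulrC addrC eqxx.
Qed.

Lemma expi2pi0 : expi2pi 0 = 1 :> R[i].
Proof. by rewrite /expi2pi mulr0 cos0 sin0. Qed.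

Lemma expi2pi_exprz x (n : int) : expi2pi x ^ n = expi2pi (n%:~R * x).
Proof.
have nat_case k : expi2pi x ^+ k = expi2pi (k%:R * x).
  elim: k => [|k IH]; first by rewrite expr0 mul0r expi2pi0.
  by rewrite exprS IH -expi2piD; congr expi2pi; rewrite -natr1; ring.
case: n => k; first exact: nat_case.
rewrite NegzE -exprnN nat_case; apply: (mulfI (expi2pi_neq0 (k.+1%:R * x))).
by rewrite mulfV ?expi2pi_neq0 // -expi2piD mulrNz mulNr subrr expi2pi0.
Qed.

Lemma expi2pi_int (n : int) : expi2pi n%:~R = 1 :> R[i].
Proof.
rewrite -[n%:~R]mulr1 -expi2pi_exprz.
have -> : expi2pi 1 = 1 :> R[i].
  by rewrite /expi2pi mulr1 mulr_natl cos2pi sin2pi.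
by rewrite exp1rz.
Qed.

(** The half-angle formula turns cos(2 pi (y - x)) = 1 into sin(pi (y - x)) = 0, impossible for 0 <
    y - x < 1. *)
Lemma expi2pi_inj x y : 0 <= x < 1 -> 0 <= y < 1 -> expi2pi x = expi2pi y -> x = y.
Proof.
wlog le_xy : x y / x <= y => [hw hx hy e|].
  by have [/hw|/ltW /hw] := leP x y; [apply|move=> h; apply/esym/h].
move=> /andP[x0 x1] /andP[y0 y1] e; apply/eqP; rewrite eq_le le_xy /= leNgt.
apply/negP => lt_xy; have : expi2pi (y - x) = 1 :> R[i].
  apply: (mulfI (expi2pi_neq0 x)); rewrite -expi2piD mulr1 e; congr expi2pi; ring.
move=> /(congr1 (@complex.Re R)) /= /eqP; rewrite -subr_eq0 cosB1 oppr_eq0 mulf_eq0 pnatr_eq0 /=.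
have -> : 2 * pi * (y - x) / 2 = pi * (y - x) by field.
rewrite sqrf_eq0 gt_eqF // sin_gt0_pi // mulr_gt0 ?pi_gt0 ?subr_gt0 //=.
by rewrite -[ltRHS]mulr1 ltr_pM2l ?pi_gt0 //; lra.
Qed.

Lemma normc_le_ReIm (z : R[i]) : Normc.normc z <= `|complex.Re z| + `|complex.Im z|.
Proof.
case: z => a b /=; rewrite -[leRHS]ger0_norm ?addr_ge0 // -sqrtr_sqr ler_wsqrtr //.
rewrite sqrrD !real_normK ?num_real //.
by have := mulr_ge0 (normr_ge0 a) (normr_ge0 b); lra.
Qed.

Lemma expi2piB1_le h : Normc.normc (expi2pi h - 1) <= 4 * pi * `|h|.
Proof.
apply: le_trans (normc_le_ReIm _) _; rewrite /= subr0.
have := cosB1_le_abs (2 * pi * h); have := sin_le_abs (2 * pi * h).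
by rewrite !normrM (ger0_norm (pi_ge0 R)) ger0_norm //; lra.
Qed.

(** The real and the imaginary part each contribute at most (2 pi h)^2. *)
Lemma expi2pi_taylor h :
  Normc.normc (expi2pi h - 1 - 'i * (2 * pi * h)%:C) <= 8 * pi ^+ 2 * h ^+ 2.
Proof.
apply: le_trans (normc_le_ReIm _) _.
have -> : complex.Re (expi2pi h - 1 - 'i * (2 * pi * h)%:C) = cos (2 * pi * h) - 1.
  by rewrite /=; ring.
have -> : complex.Im (expi2pi h - 1 - 'i * (2 * pi * h)%:C) = sin (2 * pi * h) - 2 * pi * h.
  by rewrite /=; ring.
have := cosB1_le_sqr (2 * pi * h); have := sinB_le_sqr (2 * pi * h).
rewrite !exprMn; lra.
Qed.

Lemma eq0_of_linear_bound x K d : 0 < d ->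
  (forall h, 0 < h < d -> `|x| * h <= K * h ^+ 2) -> x = 0.
Proof.
move=> d0 H; apply/eqP; rewrite -normr_le0 leNgt; apply/negP => x0.
(* [K'] is positive whatever the sign of [K]; the chosen h gives |x| <= K h <= |x| / 2. *)
pose K' := `|K| + 1; have K'0 : 0 < K' by rewrite ltr_wpDl.
pose h := Num.min (d / 2) (`|x| / (2 * K')).
have h0 : 0 < h by rewrite lt_min !divr_gt0 // mulr_gt0.
have hd : h < d by rewrite /h gt_min; apply/orP; left; lra.
have := H h; rewrite h0 hd expr2 mulrA ler_pM2r // => /(_ isT).
have : K * h <= K' * h by rewrite ler_pM2r // /K'; have := ler_norm K; lra.
have : K' * h <= K' * (`|x| / (2 * K')) by rewrite ler_pM2l // /h ge_min lexx orbT.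
have -> : K' * (`|x| / (2 * K')) = `|x| / 2 by field; lra.
lra.
Qed.

(* [2 pi 'i D] plays the role of the derivative of [p] at the origin. *)
Lemma critical_derivative (p : R -> R) (D : R[i]) (K d : R) : 0 < d ->
  (forall h, Normc.normc ((p h)%:C - 'i * (2 * pi * h)%:C * D) <= K * h ^+ 2) ->
  (exists2 s, `|s| = 1 & forall h, `|h| < d -> 0 <= s * p h) \/
  (exists C, forall h, `|h| < d -> `|p h| <= C * h ^+ 2) ->
  D = 0.
Proof.
move=> d0 HD Hp; have pi0 := pi_gt0 R.
have normRe (z : R[i]) : `|complex.Re z| <= Normc.normc z.
  by case: z => a b /=; rewrite -sqrtr_sqr ler_wsqrtr // lerDl sqr_ge0.
have normIm (z : R[i]) : `|complex.Im z| <= Normc.normc z.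
  by case: z => a b /=; rewrite -sqrtr_sqr ler_wsqrtr // lerDr sqr_ge0.
case: D HD => a b HD.
have Ia h : `|2 * pi * h * a| <= K * h ^+ 2.
  apply: le_trans (le_trans (normIm _) (HD h)); rewrite -normrN le_eqVlt; apply/orP; left.
  by apply/eqP; congr `|_|; rewrite /=; ring.
have Rb h : `|p h + 2 * pi * h * b| <= K * h ^+ 2.
  apply: le_trans (le_trans (normRe _) (HD h)); rewrite le_eqVlt; apply/orP; left.
  by apply/eqP; congr `|_|; rewrite /=; ring.
have two_pi0 : 2 * pi != 0 :> R by rewrite mulf_neq0 ?gt_eqF.
have cancel_pi x : 2 * pi * x = 0 -> x = 0.
  by move=> /eqP; rewrite mulf_eq0 (negPf two_pi0) => /eqP.
(* As [p] is real, the imaginary part of the estimate involves only the real part a of D. *)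
have a0 : a = 0.
  apply: cancel_pi; apply: (eq0_of_linear_bound (K := K) d0) => h /andP[h0 _].
  by have := Ia h; rewrite mulrAC normrM (gtr0_norm h0).
have b0 : b = 0.
  apply: cancel_pi; case: Hp => [[s s1 Hs]|[C HC]].
    apply: (eq0_of_linear_bound (K := K) d0) => h /andP[h0 hd].
    have s2 : s = 1 \/ s = -1.
      by have := eqr_norml s 1; rewrite s1 eqxx ler01 andbT => /esym/orP[]/eqP ->;
        [left|right].
    (* The linear part of p is odd in h, so a constant sign at both h and -h makes it quadratically
       small. *)
    have := Rb h; have := Rb (- h); have := Hs h; have := Hs (- h).
    rewrite normrN (gtr0_norm h0) => /(_ hd) u1 /(_ hd) u2; rewrite sqrrN.
    rewrite !ler_norml => /andP[v1 v2] /andP[v3 v4].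
    rewrite -(gtr0_norm h0) -normrM (gtr0_norm h0) ler_norml.
    by case: s2 u1 u2 => -> u1 u2; apply/andP; split; lra.
  apply: (eq0_of_linear_bound (K := K + C) d0) => h /andP[h0 hd].
  have := Rb h; have := HC h; rewrite (gtr0_norm h0) => /(_ hd).
  rewrite -(gtr0_norm h0) -normrM (gtr0_norm h0) mulrDl.
  rewrite !ler_norml => /andP[v1 v2] /andP[v3 v4]; apply/andP; split; lra.
by rewrite a0 b0.
Qed.

End Trig.

(** * Local behaviour of the determinant at a zero *)

Section Local.
Local Open Scope complex_scope.
Variable R : realType.

Lemma complex_normE (z : R[i]) : `|z| = (Normc.normc z)%:C.
Proof. by case: z. Qed.

Lemma normc_expi2pi (t : R) : Normc.normc (expi2pi t) = 1.
Proof. by rewrite /= cos2Dsin2 sqrtr1. Qed.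

Lemma normc_real (x : R) : Normc.normc x%:C = `|x|.
Proof. by rewrite /= expr0n addr0 sqrtr_sqr. Qed.

(** Apply [expi2pi_taylor] at (I t) h in each term; the remaining phases have modulus 1. *)
Lemma trig_sum_taylor (T : finType) (c : T -> R) (I J : T -> int)
    (p : R -> R) (k1 k2 : R) :
  (forall k, \sum_t (c t)%:C * expi2pi k ^ I t * expi2pi k2 ^ J t = (p k)%:C) ->
  exists K, forall h, Normc.normc ((p (k1 + h) - p k1)%:C - 'i * (2 * pi * h)%:C *
       \sum_t (c t)%:C * (I t)%:~R * expi2pi k1 ^ I t * expi2pi k2 ^ J t)
    <= K * h ^+ 2.
Proof.
move=> Hp.
exists (\sum_t `|c t| * (8 * pi ^+ 2 * (I t)%:~R ^+ 2)) => h.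
rewrite rmorphB /= -!Hp mulr_sumr -!sumrB mulr_suml; apply: le_trans (ler_normc_sum _ _) _.
apply: ler_sum => t _.
rewrite !expi2pi_exprz mulrDr expi2piD.
set e1 := expi2pi (_ * k1); set e2 := expi2pi (_ * k2); set eh := expi2pi _.
have -> : (c t)%:C * (e1 * eh) * e2 - (c t)%:C * e1 * e2
    - 'i * (2 * pi * h)%:C * ((c t)%:C * (I t)%:~R * e1 * e2)
  = (c t)%:C * e1 * e2 * (eh - 1 - 'i * (2 * pi * ((I t)%:~R * h))%:C).
  have -> : (2 * pi * ((I t)%:~R * h))%:C = (2 * pi * h)%:C * (I t)%:~R.
    by rewrite -(rmorph_int (real_complex R)) -rmorphM /=; congr (_%:C); ring.
  by ring.
rewrite !Normc.normcM !normc_expi2pi normc_real !mulr1 -[leRHS]mulrA.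
apply: ler_wpM2l => //.
by apply: le_trans (expi2pi_taylor _) _; rewrite exprMn mulrA.
Qed.

(** If a second factor vanishes at 0, two factors are O(h) and the rest stay bounded. Otherwise
    every factor other than m keeps its sign near 0, and factor m has a constant sign by
    assumption. *)
Lemma product_near_zero n (x : R -> 'I_n -> R) (m : 'I_n) (L : R) :
  (forall h i, `|x h i - x 0 i| <= L * `|h|) -> x 0 m = 0 ->
  (forall h, x h m <= 0) \/ (forall h, 0 <= x h m) ->
  exists2 d, 0 < d &
    (exists2 s, `|s| = 1 & forall h, `|h| < d -> 0 <= s * \prod_i x h i) \/
    (exists C, forall h, `|h| < d -> `|\prod_i x h i| <= C * h ^+ 2).
Proof.
move=> lip xm0 sgn; have L0 : 0 <= L.
  by have := lip 1 m; rewrite normr1 mulr1; apply: le_trans.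
have [[j [jm xj0]]|simple] := pselect (exists j, j != m /\ x 0 j = 0).
  exists 1 => //; right.
  exists (L ^+ 2 * \prod_(i | (i != m) && (i != j)) (`|x 0 i| + L)) => h h1.
  have xh i : x 0 i = 0 -> `|x h i| <= L * `|h|.
    by move=> e; have := lip h i; rewrite e subr0.
  rewrite (bigD1 m) //= (bigD1 j) //= !normrM normr_prod.
  have -> : L ^+ 2 * \prod_(i | (i != m) && (i != j)) (`|x 0 i| + L) * h ^+ 2 =
      (L * `|h|) * ((L * `|h|) * \prod_(i | (i != m) && (i != j)) (`|x 0 i| + L)).
    by rewrite -(real_normK (num_real h)); ring.
  apply: ler_pM; rewrite ?mulr_ge0 ?prodr_ge0 ?xh //.
  apply: ler_pM; rewrite ?prodr_ge0 ?xh //.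
  apply: ler_prod => i _; rewrite normr_ge0 /=.
  have := ler_normD (x 0 i) (x h i - x 0 i); rewrite [x 0 i + _]addrC subrK.
  have : L * `|h| <= L by rewrite ler_piMr // ltW.
  by have := lip h i; lra.
(* For |h| < 1/D no factor with [x 0 i != 0] changes by more than |x 0 i|. The summand at m is
   harmless: division by zero gives 0. *)
pose D := 1 + \sum_i (L + 1) / `|x 0 i|.
have terms i : 0 <= (L + 1) / `|x 0 i| by rewrite divr_ge0 // addr_ge0.
have D1 : 1 <= D by rewrite lerDl sumr_ge0.
have D0 : 0 < D := lt_le_trans ltr01 D1.
exists D^-1; first by rewrite invr_gt0.
have [t t1 Ht] : exists2 t : R, `|t| = 1 & forall h, 0 <= t * x h m.
  case: sgn => H; last by exists 1 => [|h]; rewrite ?normr1 ?mul1r.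
  by exists (-1) => [|h]; rewrite ?normrN1 // mulN1r oppr_ge0.
left; exists (\prod_i (if i == m then t else Num.sg (x 0 i))) => [|h hD].
  rewrite normr_prod big1 // => i _; case: eqVneq => [_ //|im].
  rewrite normr_sg; case: eqP => // e; case: simple; by exists i.
rewrite -big_split /=; apply: prodr_ge0 => i _; case: eqVneq => [-> //|im].
have xi0 : x 0 i != 0 by apply/eqP => e; apply: simple; exists i.
have : L * `|h| <= `|x 0 i|.
  have le1 : (L + 1) / `|x 0 i| <= D.
    rewrite /D (bigD1 i) //= addrCA lerDl addr_ge0 ?ler01 //.
    by apply: sumr_ge0.
  have : (L + 1) * D^-1 <= `|x 0 i|.
    by rewrite ler_pdivrMr // mulrC -ler_pdivrMr ?normr_gt0.
  apply: le_trans; apply: ler_pM => //; last exact: ltW.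
  by rewrite lerDl.
move: (lip h i) => /le_trans /[apply].
set y := x h i - x 0 i => yle.
have -> : x h i = y + x 0 i by rewrite /y subrK.
rewrite mulrDr -normrEsg.
have : `|Num.sg (x 0 i) * y| <= `|x 0 i|.
  by rewrite normrM normr_sg xi0 mul1r.
by rewrite ler_norml => /andP[]; lra.
Qed.

End Local.

(** * Regularity and critical points of the band functions *)

Section Floquet.
Local Open Scope complex_scope.
Variables (R : realType) (q1 q2 : nat) (V : int * int -> R).
Hypotheses (q1_gt0 : (0 < q1)%N) (q2_gt0 : (0 < q2)%N).
Local Notation N := (q1 * q2)%N.

Lemma DV_lipschitz (k1 k2 : R) : exists e : R, forall h a b,
  `|DV q1 q2 V (k1 + h) k2 a b - DV q1 q2 V k1 k2 a b| <= (e * `|h|)%:C.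
Proof.
(* [B a o] bounds the variation of one directional term per unit of h; summing over all rows makes
   the constant independent of the entry. *)
pose B (a : 'I_N) (o : 'I_5) := `|dir_weight V 0 a o| * (4 * pi * `|(wind1 a o)%:~R : R|).
have B0 a o : 0 <= B a o by rewrite /B !mulr_ge0 ?pi_ge0.
exists (\sum_a \sum_o B a o) => h a b.
rewrite [X in `|X - _|](DV_entry q1_gt0 q2_gt0).
rewrite [X in `|_ - X|](DV_entry q1_gt0 q2_gt0).
rewrite -sumrB complex_normE lecR.
apply: le_trans (ler_normc_sum _ _) _.
apply: (@le_trans _ _ ((\sum_o B a o) * `|h|)); last first.
  rewrite ler_wpM2r // (bigD1 a) //= lerDl sumr_ge0 // => a' _.
  by rewrite sumr_ge0.
rewrite mulr_suml; apply: ler_sum => o _.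
rewrite -mulrBl -mulrBr -mulrBl !expi2pi_exprz mulrDr expi2piD.
rewrite -[X in _ * ((_ - X) * _)]mulr1 -mulrBr !Normc.normcM !normc_expi2pi mul1r mulr1.
rewrite normc_real -[leRHS]mulr1; apply: ler_pM; rewrite ?mulr_ge0 //.
- by case: (_ - 1) => ? ?; exact: sqrtr_ge0.
- by case: (_%:R) => ? ?; exact: sqrtr_ge0.
- rewrite /B -mulrA ler_wpM2l //; apply: le_trans (expi2piB1_le _) _.
  by rewrite normrM mulrA.
- by rewrite -(rmorph_nat (real_complex R)) normc_real normr_nat; case: hit.
Qed.

Lemma det_sub_eigenvalues n (A : 'M[R[i]]_n) (lam : 'I_n -> R) (l : R) :
  sorted_eigenvalues A lam ->
  \det (A - (l%:C)%:M) = (\prod_i (lam i - l))%:C.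
Proof.
move=> [_ cA].
have : (char_poly A).[l%:C] = \det ((l%:C)%:M - A).
  rewrite -horner_evalE /char_poly -det_map_mx; congr (\det _).
  apply/matrixP => i j; rewrite !mxE /= horner_evalE hornerD hornerN hornerC hornerMn.
  by rewrite hornerX.
rewrite cA horner_prod => e.
have -> : A - (l%:C)%:M = - 1 *: ((l%:C)%:M - A) by rewrite scaleN1r opprB.
rewrite detZ -e rmorph_prod /=.
transitivity (\prod_(i < n) (-1 * ('X - ((lam i)%:C)%:P).[l%:C])).
  by rewrite big_split /= prodr_const card_ord.
by apply: eq_bigr => i _; rewrite hornerXsubC mulN1r opprB rmorphB.
Qed.

Variable lam : R -> R -> 'I_N -> R.
Hypothesis lam_eig : forall k1 k2, sorted_eigenvalues (DV q1 q2 V k1 k2) (lam k1 k2).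

Lemma lam_lipschitz (k1 k2 : R) : exists L : R, forall h i,
  `|lam (k1 + h) k2 i - lam k1 k2 i| <= L * `|h|.
Proof.
have [e He] := DV_lipschitz k1 k2; exists (N%:R * e) => h i.
have H k := DV_hermitian q1_gt0 q2_gt0 V k k2.
have He' a b : `|DV q1 q2 V k1 k2 a b - DV q1 q2 V (k1 + h) k2 a b| <= (e * `|h|)%:C.
  by rewrite distrC.
have w1 := weyl_inequality i (H (k1 + h)) (H k1) (lam_eig _ _) (lam_eig _ _) (He h).
have w2 := weyl_inequality i (H k1) (H (k1 + h)) (lam_eig _ _) (lam_eig _ _) He'.
by rewrite ler_norml; apply/andP; split; rewrite -mulrA; lra.
Qed.

Lemma lam_periodic (k1 k2 : R) (n : int) i : lam (k1 + n%:~R) k2 i = lam k1 k2 i.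
Proof.
apply: (sorted_eigenvalues_unique i (DV_hermitian q1_gt0 q2_gt0 V k1 k2) _ (lam_eig _ _)).
have -> : DV q1 q2 V k1 k2 = DV q1 q2 V (k1 + n%:~R) k2.
  apply/matrixP => a b.
  rewrite [LHS](DV_entry q1_gt0 q2_gt0) [RHS](DV_entry q1_gt0 q2_gt0).
  by rewrite expi2piD expi2pi_int mulr1.
exact: lam_eig.
Qed.

Lemma dispersion_eq (k1 k2 l : R) :
  \sum_(f : {ffun 'I_N -> 'I_5}) (weight V l f)%:C * expi2pi k1 ^ winding1 f * expi2pi k2 ^ winding2 f =
  (\prod_i (lam k1 k2 i - l))%:C.
Proof. by rewrite -det_DV // (det_sub_eigenvalues _ (lam_eig _ _)). Qed.

(** Along the line of fixed k2 the determinant is the product of the [lam i - l], to which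
    [product_near_zero] applies; its first-order term is the displayed sum, up to the factor 2 pi
    i. *)
Lemma extremum_critical (m : 'I_N) (k1 k2 l : R) : lam k1 k2 m = l ->
  (forall k, lam k k2 m <= l) \/ (forall k, l <= lam k k2 m) ->
  \sum_(f : {ffun 'I_N -> 'I_5}) (weight V l f)%:C * (winding1 f)%:~R
    * expi2pi k1 ^ winding1 f * expi2pi k2 ^ winding2 f = 0.
Proof.
move=> lm ext; have [L HL] := lam_lipschitz k1 k2.
have [d d0 Hd] : exists2 d, 0 < d &
    (exists2 s, `|s| = 1 & forall h, `|h| < d -> 0 <= s * \prod_i (lam (k1 + h) k2 i - l)) \/
    (exists C, forall h, `|h| < d -> `|\prod_i (lam (k1 + h) k2 i - l)| <= C * h ^+ 2).
  apply: (@product_near_zero R N (fun h i => lam (k1 + h) k2 i - l) m L).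
  - by move=> h i; rewrite addr0 opprB addrA subrK.
  - by rewrite addr0 lm subrr.
  - by case: ext => H; [left|right] => h; rewrite ?subr_le0 ?subr_ge0.
have p0 : \prod_i (lam k1 k2 i - l) = 0 by rewrite (bigD1 m) //= lm subrr mul0r.
have [K HK] := trig_sum_taylor k1 (fun k => dispersion_eq k k2 l).
apply: (critical_derivative (K := K) d0 _ Hd) => h.
by have := HK h; rewrite p0 subr0.
Qed.

End Floquet.

(** * Counting the level set *)

Theorem theorem3p1 (R : realType) (q1 q2 : nat) (V : int * int -> R)
    (lam : R -> R -> 'I_(q1 * q2) -> R) (m : 'I_(q1 * q2)) (lstar : R) :
  (0 < q1)%N -> (0 < q2)%N -> coprime q1 q2 ->
  qperiodic q1 q2 V ->
  (forall k1 k2 : R, sorted_eigenvalues (DV q1 q2 V k1 k2) (lam k1 k2)) ->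
  is_extremum (fun k : R * R => lam k.1 k.2 m) lstar ->
  forall s : seq (R * R), uniq s ->
    (forall k, k \in s -> in_unit_square k /\ lam k.1 k.2 m = lstar) ->
    (size s <= 9 * q1 * q2 - 3)%N.
Proof.
move=> q1_gt0 q2_gt0 cop _ lam_eig [ext _] s us hs.
pose pt (k : R * R) := (expi2pi k.1, expi2pi k.2).
(* Periodicity extends extremality from [0,1) to the whole line, so points with k1 = 0 also have
   neighbours on both sides. *)
have ext_line k2 : 0 <= k2 < 1 ->
    (forall k, lam k k2 m <= lstar) \/ (forall k, lstar <= lam k k2 m).
  move=> hk2.
  have red k : exists2 k', 0 <= k' < 1 & lam k k2 m = lam k' k2 m.
    exists (k - (Num.floor k)%:~R).
      have /andP[h1 h2] := floor_itv k; move: h2; rewrite intrD.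
      by rewrite subr_ge0 h1 ltrBlDl.
    by rewrite -{1}[k](subrK (Num.floor k)%:~R) (lam_periodic q1_gt0 q2_gt0 lam_eig).
  case: ext => H; [left|right] => k; have [k' hk' ->] := red k;
  by apply: (H (k', k2)); split.
have -> : size s = size (map pt s) by rewrite size_map.
(* The count is 8 q1 q2 - 2 q1, and q1 q2 + 2 q1 >= 3. *)
apply: (@leq_trans ((2 * q2).-1 * (2 * q1) + 2 * q2 * (2 * q1))); last by nia.
pose dir (k : nat) : {ffun 'I_(q1 * q2) -> 'I_5} := [ffun=> inord k].
have N_gt0 : (0 < q1 * q2)%N by rewrite muln_gt0 q1_gt0.
have dirE k k' : (k < 5)%N -> (k' < 5)%N -> (dir k == dir k') = (k == k').
  move=> lk lk'; apply/eqP/eqP => [/ffunP /(_ (Ordinal N_gt0))|-> //].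
  by rewrite !ffunE => /(congr1 val) /=; rewrite !inordK.
have vsE t : t \in [:: dir 0; dir 1; dir 2; dir 3] -> exists2 o : 'I_5, (o < 4)%N & t = [ffun=> o].
  by rewrite !inE => /or4P[] /eqP ->; [exists (inord 0)|exists (inord 1)|exists (inord 2)|exists (inord 3)];
    rewrite // inordK.
apply: (@diamond_critical_points_bound R _ q1 q2 (weight V lstar) (@winding1 q1 q2)
  (@winding2 q1 q2) (dir 0) (dir 1) (dir 2) (dir 3)) => //.
- by rewrite /= !inE !dirE.
- by move=> t /vsE[o o4 ->]; exact: weight_const.
- by rewrite (winding_const q1_gt0 q2_gt0 _).1 /step1 inordK //= mul1r.
- by rewrite (winding_const q1_gt0 q2_gt0 _).2 /step2 inordK //= mul0r.
- by rewrite (winding_const q1_gt0 q2_gt0 _).1 /step1 inordK //= mulN1r.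
- by rewrite (winding_const q1_gt0 q2_gt0 _).2 /step2 inordK //= mul0r.
- by rewrite (winding_const q1_gt0 q2_gt0 _).1 /step1 inordK //= mul0r.
- by rewrite (winding_const q1_gt0 q2_gt0 _).2 /step2 inordK //= mul1r.
- by rewrite (winding_const q1_gt0 q2_gt0 _).1 /step1 inordK //= mul0r.
- by rewrite (winding_const q1_gt0 q2_gt0 _).2 /step2 inordK //= mulN1r.
(* A nonzero weight comes from a permutation of the sites, and a choice that is not a vertex is not
   one of the four constant moves. *)
- move=> f /weight_neq0_perm[p hp] nf; apply: (inner_winding q1_gt0 q2_gt0 cop hp) => o o4.
  apply: contraNneq nf => ->; rewrite !inE.
  have -> : [ffun=> o] = dir o.
    by apply/ffunP => a; rewrite !ffunE; apply: val_inj; rewrite /= inordK.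
  by rewrite !dirE //; case: (nat_of_ord o) o4 => [|[|[|[|]]]].
(* On the half-open unit square distinct k give distinct pairs of phases, so no points are lost in
   passing to (x, y). *)
- rewrite map_inj_in_uniq // => -[x1 x2] [y1 y2] /hs[[hx1 hx2] _] /hs[[hy1 hy2] _] [e1 e2 e3 e4].
  congr (_, _).
    by apply: expi2pi_inj => //; rewrite /expi2pi e1 e2.
  by apply: expi2pi_inj => //; rewrite /expi2pi e3 e4.
- move=> z /mapP[[k1 k2] /hs[[hk1 hk2] /= lk] ->] /=; split; try exact: expi2pi_neq0.
    by rewrite (dispersion_eq q1_gt0 q2_gt0 lam_eig) (bigD1 m) //= lk subrr mul0r.
  exact: (extremum_critical q1_gt0 q2_gt0 lam_eig lk (ext_line _ hk2)).
Qed.
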